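(* For every $n\ge1$ the function $\widehat c_n:G(X)\to\mathbb{C}$ is constant on fibres of the quotient homomorphism $\pi:G(X)\to Q(X)=G(X)/\widehat{\mathcal{C}}$ and therefore determines a function $\overline c_n:Q(X)\to\mathbb{C}$ such that $\overline c_n\circ\pi=\widehat c_n$.
   Context: Functions on the circle $S^1$ are identified with $2\pi$-periodic functions on $\mathbb{R}$. $X$ is the complex vector space of sequences $a=(a_1,a_2,\dots)$ with $a_i\in L^\infty(S^1)$ (complex-valued) for which there is $l>0$ (depending on $a$) with $\sup_{x\in S^1}|a_i(x)|\le l^i$ for all $i\ge1$ (sup understood as the $L^\infty$-norm). For $a,b\in X$: $a*b=(a_1*b_1,a_2*b_2,\dots)\in X$ and $a^{-1}=(a_1^{-1},a_2^{-1},\dots)\in X$, where $(a_i*b_i)(t)=2a_i(2t)$ for $0<t\le\pi$, $(a_i*b_i)(t)=2b_i(2t-2\pi)$ for $\pi<t\le2\pi$, and $a_i^{-1}(t)=-a_i(2\pi-t)$ for $0<t\le2\pi$ (extended $2\pi$-periodically). Basic iterated integrals on $X$: $I_{i_1,\dots,i_k}(a)=\int\cdots\int_{0\le s_1\le\cdots\le s_k\le2\pi}a_{i_k}(s_k)\cdots a_{i_1}(s_1)\,ds_k\cdots ds_1$. $\mathcal{U}\subset X$ is the set of $a$ at which all $I_{i_1,\dots,i_k}$ with $k\ge1$ vanish. The relation $a\sim b$ iff $a*b^{-1}\in\mathcal{U}$ is an equivalence relation; $G(X)$ is the set of classes $[a]$, a group under $[a]\cdot[b]=[a*b]$ with unit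 $[0]$. For $a\in X$ and sufficiently small $r$ let $v(x;r;a)$, $x\in[0,2\pi]$, be the unique Lipschitz function satisfying $\frac{dv}{dx}=\sum_{i\ge1}a_i(x)v^{i+1}$ almost everywhere and $v(0;r;a)=r$. The first return map $P(a)(r):=v(2\pi;r;a)$ has for small $r$ an absolutely convergent expansion $P(a)(r)=r+\sum_{n\ge1}c_n(a)r^{n+1}$, where $c_n(a)=\sum_{i_1+\dots+i_k=n}\big(\prod_{j=1}^k(n-i_1-\dots-i_j+1)\big)I_{i_1,\dots,i_k}(a)$. The $c_n$ are constant on $\sim$-classes, and $\widehat c_n([a]):=c_n(a)$. $\widehat{\mathcal{C}}\subset G(X)$ is the normal subgroup of classes $[a]$ with $P(a)(r)\equiv r$ (the kernel of $\widehat P([a])=P(a)$). *)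

(* Defs.v *)
From HB Require Import structures.
From mathcomp Require Import all_boot all_order all_algebra.
From mathcomp Require Import complex generic_quotient.
From mathcomp Require Import all_classical all_reals all_analysis measurable_realfun.
From mathcomp Require Import ring lra.
Set Implicit Arguments.
Unset Strict Implicit.
Unset Printing Implicit Defensive.
Import Order.TTheory GRing.Theory Num.Theory.
Import numFieldNormedType.Exports.
Local Open Scope classical_set_scope.
Local Open Scope ring_scope.
Import ComplexField.
Local Open Scope complex_scope.
Local Open Scope quotient_scope.

(* Complex functions on the circle are 2 pi-periodic functions R -> R[i], and
   [a k] stands for the coefficient a_{k+1}: sequences indexed by i >= 1 are
   shifted to start at 0, so words [w : seq nat] list the numbers i_j - 1.
   Elements of L^oo are represented by actual measurable functions; two
   sequences that agree almost everywhere have the same iterated integrals,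
   hence the same class in the group [G] below. *)
Section BasicDefinitions.
Variable R : realType.
Local Notation C := R[i].
Local Notation mu := (@lebesgue_measure R).
Local Notation Re := (@complex.Re R).
Local Notation Im := (@complex.Im R).
Local Notation tpi := (2 * pi : R).

Definition cmeasurable (f : R -> C) :=
  measurable_fun setT (Re \o f) /\ measurable_fun setT (Im \o f).

Definition in_X (a : nat -> R -> C) :=
  [/\ forall k x, a k (x + tpi) = a k x,
      forall k, cmeasurable (a k) &
      exists2 l : R, 0 < l &
        forall k, {ae mu, forall x, 0 <= x <= tpi ->
                     Normc.normc (a k x) <= l ^+ k.+1}].

(* The 2 pi-periodic function that agrees with [f] on ]0, 2 pi]. *)
Definition periodize (f : R -> C) (x : R) : C :=
  f (x - tpi * (Num.ceil (x / tpi) - 1)%:~R).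

Definition concat_fun (a b : nat -> R -> C) (k : nat) : R -> C :=
  periodize (fun t => if t <= pi then 2 * a k (2 * t)
                      else 2 * b k (2 * t - tpi)).

Definition inverse_fun (a : nat -> R -> C) (k : nat) : R -> C :=
  periodize (fun t => - a k (tpi - t)).

Definition cint (A : set R) (f : R -> C) : C :=
  (\int[mu]_(x in A) Re (f x)) +i* (\int[mu]_(x in A) Im (f x)).

(* For [w = [:: k1; ..; kn]] and t >= 0, the iterated integral of
   [a kn s_n * .. * a k1 s_1] over 0 <= s_1 <= .. <= s_n <= t: the head of the
   word carries the smallest, innermost variable. *)
Definition iter_int (a : nat -> R -> C) (w : seq nat) : R -> C :=
  foldl (fun F k t => cint `[0, t] (fun s => a k s * F s)) (fun=> 1) w.

Definition total_int (a : nat -> R -> C) (w : seq nat) : C :=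
  iter_int a w tpi.

End BasicDefinitions.

Section RealLemmas.
Variable R : realType.
Local Notation mu := (@lebesgue_measure R).

Definition affine (al be x : R) : measurableTypeR R := al * x + be.

Lemma measurable_affine al be : measurable_fun setT (affine al be).
Proof. by apply: measurable_funD => //; exact: measurable_funM. Qed.

Lemma affine_measure (al be : R) (A : set R) : al != 0 -> measurable A ->
  pushforward (mscale (NngNum (normr_ge0 al)) mu) (affine al be) A = mu A.
Proof.
move=> al0 mA; apply/esym/lebesgue_measure_unique => //=.
  exact: measurable_affine.
move=> _ mphi [[a b]] _ <- /=.
rewrite /pushforward /mscale /=.
have [al_gt0|al_lt0] : 0 < al \/ al < 0.
  by apply/orP; rewrite orbC -neq_lt.
- rewrite (_ : affine al be @^-1` _ = `](a - be) / al, (b - be) / al]%classic); last first.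
    apply/seteqP; split=> x /=; rewrite !in_itv/= /affine ltr_pdivrMr// ler_pdivlMr// (mulrC x);
    by rewrite ltrBlDr lerBrDr.
  rewrite !lebesgue_measure_itv/= !lte_fin ltr_pM2r ?invr_gt0// ltrD2r.
  case: ifPn => // _; last by rewrite mule0.
  rewrite -EFinB -EFinM gtr0_norm//; congr EFin; field; exact: lt0r_neq0.
- rewrite (_ : affine al be @^-1` _ = `[(b - be) / al, (a - be) / al[%classic); last first.
    apply/seteqP; split=> x /=; rewrite !in_itv/= /affine ltr_ndivlMr// ler_ndivrMr// (mulrC x);
    by rewrite ltrBlDr lerBrDr andbC.
  rewrite !lebesgue_measure_itv/= !lte_fin ltr_nM2r ?invr_lt0// ltrD2r.
  case: ifPn => // _; last by rewrite mule0.
  rewrite -EFinB -EFinM ltr0_norm//; congr EFin; field; exact: ltr0_neq0.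
Qed.

Lemma ge0_integral_affine (al be : R) (D : set R) (f : R -> \bar R) : al != 0 ->
  measurable D -> measurable_fun D f -> (forall x, D x -> 0 <= f x)%E ->
  (\int[mu]_(x in D) f x =
   \int[mu]_(x in affine al be @^-1` D) (`|al|%:E * f (affine al be x)))%E.
Proof.
move=> al0 mD mf f0.
have mphi := measurable_affine al be.
have mD' : measurable (affine al be @^-1` D).
  by rewrite -[X in measurable X]setTI; exact: mphi.
have mf' : measurable_fun (affine al be @^-1` D) (f \o affine al be).
  apply: (@measurable_comp _ _ _ _ _ _ D f _ (affine al be)) => //.
    by move=> _ [x xD <-].
  by apply: measurable_funS mphi.
rewrite ge0_integralZl//; last first.
  by move=> x /f0.
rewrite -(ge0_integral_mscale mu mD' (NngNum (normr_ge0 al)) mf')//; last first.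
  by move=> x /f0.
transitivity (\int[pushforward (mscale (NngNum (normr_ge0 al)) mu) (affine al be)]_(x in D) f x)%E.
  by apply: eq_measure_integral => A mA _; exact/esym/affine_measure.
apply: ge0_integral_pushforward => //.
by move=> x /[!inE] /f0.
Qed.

Lemma Rintegral_affine (al be : R) (D : set R) (f : R -> R) : al != 0 ->
  measurable D -> measurable_fun D f ->
  \int[mu]_(x in D) f x =
  \int[mu]_(x in affine al be @^-1` D) (`|al| * f (affine al be x)).
Proof.
move=> al0 mD mf; rewrite /Rintegral integralE [in RHS]integralE.
have mf' : measurable_fun D (EFin \o f) by exact/measurable_EFinP.
congr (fine (_ - _)).
- rewrite (ge0_integral_affine be al0)//; last exact: measurable_funepos.
  by apply: eq_integral => x _; rewrite !funeposE maxe_pMr ?mule0.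
- rewrite (ge0_integral_affine be al0)//; last exact: measurable_funeneg.
  by apply: eq_integral => x _; rewrite !funenegE maxe_pMr ?mule0 ?muleN.
Qed.

Lemma aeS (P Q : R -> Prop) : (forall x, P x -> Q x) ->
  {ae mu, forall x, P x} -> {ae mu, forall x, Q x}.
Proof. by move=> PQ; apply: filterS; first exact: (ae_filter_ringOfSetsType mu). Qed.

Lemma aeS2 (P Q S : R -> Prop) : (forall x, P x -> Q x -> S x) ->
  {ae mu, forall x, P x} -> {ae mu, forall x, Q x} -> {ae mu, forall x, S x}.
Proof. by move=> PQ; apply: filterS2; first exact: (ae_filter_ringOfSetsType mu). Qed.

Lemma aeT (P : R -> Prop) : (forall x, P x) -> {ae mu, forall x, P x}.
Proof. by move=> PT; apply: (@aeW _ _ _ mu). Qed.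

Definition bdm (T : R) (f : R -> R) := measurable_fun `[0, T] f /\
  exists M, {ae mu, forall x, 0 <= x <= T -> `|f x| <= M}.

Lemma bdm_cst T c : bdm T (fun=> c).
Proof. by split=> //; exists `|c|; apply: aeT => x _. Qed.

Lemma bdmD T f g : bdm T f -> bdm T g -> bdm T (fun x => f x + g x).
Proof.
move=> [mf [M fM]] [mg [N gN]]; split; first exact: measurable_funD.
exists (M + N); apply: aeS2 fM gN => x fM gN xT.
by rewrite (le_trans (ler_normD _ _))// lerD ?fM ?gN.
Qed.

Lemma bdmM T f g : bdm T f -> bdm T g -> bdm T (fun x => f x * g x).
Proof.
move=> [mf [M fM]] [mg [N gN]]; split; first exact: measurable_funM.
exists (M * N); apply: aeS2 fM gN => x fM gN xT.
by rewrite normrM ler_pM ?fM ?gN.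
Qed.

Lemma bdmN T f : bdm T f -> bdm T (fun x => - f x).
Proof.
move=> [mf [M fM]]; split; first exact: measurableT_comp.
by exists M; apply: aeS fM => x fM xT; rewrite normrN fM.
Qed.

Lemma bdmB T f g : bdm T f -> bdm T g -> bdm T (fun x => f x - g x).
Proof. by move=> bf bg; apply: bdmD => //; exact: bdmN. Qed.

Lemma bdm_integrable T f (A : set R) : bdm T f -> measurable A ->
  A `<=` `[0, T] -> mu.-integrable A (EFin \o f).
Proof.
move=> [mf [M fM]] mA AT.
have mfA : measurable_fun A (EFin \o f).
  by apply/measurable_EFinP; exact: measurable_funS mf.
apply/integrableP; split=> //.
apply: (@le_lt_trans _ _ (\int[mu]_(x in A) (`|M|%:E))%E).
  apply: ae_ge0_le_integral => //.
  - exact: measurableT_comp.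
  - apply: aeS fM => x fM /AT/=; rewrite in_itv/= => /fM h.
    by rewrite lee_fin (le_trans h)// ler_norm.
have muA : (mu A < +oo)%E.
  apply: (@le_lt_trans _ _ (mu `[0, T])); first by apply: le_measure; rewrite ?inE.
  by rewrite lebesgue_measure_itv/=; case: ifP => _; rewrite ?ltry.
by rewrite integral_cst//= lte_mul_pinfty.
Qed.

Lemma bdm_int T f : 0 <= T -> bdm T f -> bdm T (fun x => \int[mu]_(t in `[0, x]) f t).
Proof.
move=> T0 bf; have fT : mu.-integrable `[0, T] (EFin \o f).
  exact: bdm_integrable bf _ _.
have cF := @parameterized_integral_continuous _ _ _ _ T0 fT.
split; first exact: subspace_continuous_measurable_fun cF.
exists (\int[mu]_(t in `[0, T]) `|f t|); apply: aeT => x /andP[x0 xT].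
have xTs : `[0, x] `<=` `[0, T] by apply: subset_itvl; rewrite bnd_simp.
have intx := bdm_integrable bf (measurable_itv `[0, x]) xTs.
apply: le_trans (le_normr_Rintegral _ intx) _ => //.
rewrite /Rintegral fine_le//.
- by apply: integrable_fin_num => //; exact: (integrable_abse intx).
- by apply: integrable_fin_num => //; exact: (integrable_abse fT).
apply: ge0_subset_integral => //.
by apply/measurable_EFinP; apply: measurableT_comp => //; case: bf.
Qed.

End RealLemmas.

Section ComplexIntegrals.
Variable R : realType.
Local Notation C := R[i].
Local Notation mu := (@lebesgue_measure R).
Local Notation Re := (@complex.Re R).
Local Notation Im := (@complex.Im R).
Local Notation tpi := (2 * pi : R).

Lemma tpi_gt0 : 0 < tpi. Proof. by rewrite mulr_gt0// pi_gt0. Qed.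
Lemma ReM (x y : C) : Re (x * y) = Re x * Re y - Im x * Im y.
Proof. by case: x y => [? ?] [? ?]. Qed.
Lemma ImM (x y : C) : Im (x * y) = Re x * Im y + Im x * Re y.
Proof. by case: x y => [? ?] [? ?] /=. Qed.
Lemma Re_le_normc (z : C) : `|Re z| <= Normc.normc z.
Proof.
by case: z => x y /=; rewrite -sqrtr_sqr ler_wsqrtr// lerDl sqr_ge0.
Qed.
Lemma Im_le_normc (z : C) : `|Im z| <= Normc.normc z.
Proof.
by case: z => x y /=; rewrite -sqrtr_sqr ler_wsqrtr// lerDr sqr_ge0.
Qed.

Lemma periodize_id (f : R -> C) x : 0 < x <= tpi -> periodize f x = f x.
Proof.
move=> /andP[x0 xT]; rewrite /periodize.
rewrite (_ : Num.ceil _ = 1) ?subrr ?mulr0 ?subr0//.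
apply: ceil_def; rewrite subrr divr_gt0 ?tpi_gt0//=.
by rewrite ler_pdivrMr ?tpi_gt0// mul1r.
Qed.

Lemma periodize_period (f : R -> C) x : periodize f (x + tpi) = periodize f x.
Proof.
rewrite /periodize.
have -> : (x + tpi) / tpi = x / tpi + 1%:~R.
  by rewrite [LHS]mulrDl (divff (lt0r_neq0 tpi_gt0)).
rewrite ceilDrz// intrKceil !intrD; congr f; ring.
Qed.

Definition cbd (f : R -> C) := bdm tpi (Re \o f) /\ bdm tpi (Im \o f).

Lemma cbd_cst c : cbd (fun=> c).
Proof. by split; exact: bdm_cst. Qed.

Lemma cbdD f g : cbd f -> cbd g -> cbd (fun x => f x + g x).
Proof.
move=> [rf if_] [rg ig]; split.
  rewrite (_ : _ \o _ = fun x => (Re \o f) x + (Re \o g) x); first exact: bdmD.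
  by apply/funext => x /=; rewrite raddfD.
rewrite (_ : _ \o _ = fun x => (Im \o f) x + (Im \o g) x); first exact: bdmD.
by apply/funext => x /=; rewrite raddfD.
Qed.

Lemma cbdM f g : cbd f -> cbd g -> cbd (fun x => f x * g x).
Proof.
move=> [rf if_] [rg ig]; split.
  rewrite (_ : _ \o _ = fun x => (Re \o f) x * (Re \o g) x -
                                 (Im \o f) x * (Im \o g) x).
    by apply: bdmB; exact: bdmM.
  by apply/funext => x /=; rewrite ReM.
rewrite (_ : _ \o _ = fun x => (Re \o f) x * (Im \o g) x +
                                 (Im \o f) x * (Re \o g) x).
  by apply: bdmD; exact: bdmM.
by apply/funext => x /=; rewrite ImM.
Qed.

Lemma cbd_int f : cbd f -> cbd (fun t => cint `[0, t] f).
Proof. by move=> [rf if_]; split; apply: bdm_int => //; exact/ltW/tpi_gt0. Qed.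

Definition oint (x y : R) f := cint `]x, y[ f.

Lemma cint_oint t f : 0 <= t <= tpi -> cbd f -> cint `[0, t] f = oint 0 t f.
Proof.
move=> /andP[t0 tT] [rf if_]; rewrite /oint /cint.
have H (g : R -> R) : bdm tpi g ->
    \int[mu]_(x in `[0, t]) g x = \int[mu]_(x in `]0, t[) g x.
  move=> bg.
  have ig (b1 b2 : bool) :
      mu.-integrable [set` Interval (BSide b1 0) (BSide b2 t)] (EFin \o g).
    apply: bdm_integrable bg _ _ => //.
    by apply: subset_itv; case: b1 b2 => -[] //=; rewrite bnd_simp.
  by rewrite -Rintegral_itv_obnd_cbnd// -Rintegral_itv_bndo_bndc.
by rewrite (H (Re \o f))// (H (Im \o f)).
Qed.

Lemma oint_cat (x y z : R) f : 0 <= x -> x <= y -> y <= z -> z <= tpi -> cbd f ->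
  oint x z f = oint x y f + oint y z f.
Proof.
move=> x0 xy yz zT [rf if_]; rewrite /oint /cint.
have H (g : R -> R) : bdm tpi g ->
    \int[mu]_(u in `]x, z[) g u = \int[mu]_(u in `]x, y[) g u +
                                  \int[mu]_(u in `]y, z[) g u.
  move=> bg.
  have ig (u v : R) (b1 b2 : bool) : 0 <= u -> v <= tpi ->
      mu.-integrable [set` Interval (BSide b1 u) (BSide b2 v)] (EFin \o g).
    move=> u0 vT; apply: bdm_integrable bg _ _ => //.
    by apply: subset_itv; case: b1 b2 => -[] //=; rewrite bnd_simp.
  have yT := le_trans yz zT; have y0 := le_trans x0 xy.
  have [xz|xz] := ltP x z; last first.
    have -> : y = x by apply/eqP; rewrite eq_le xy (le_trans yz xz).
    by rewrite !set_itv_ge -?leNgt ?bnd_simp// !Rintegral_set0 addr0.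
  rewrite (Rintegral_itv_bndo_bndc (ig _ _ _ _ x0 yT)).
  have [yz'|zy] := ltP y z; last first.
    have -> : y = z by apply/eqP; rewrite eq_le yz zy.
    rewrite [X in _ = _ + X](_ : _ = 0) ?addr0; last first.
      by rewrite set_itv_ge -?leNgt ?bnd_simp// Rintegral_set0.
    by rewrite -Rintegral_itv_bndo_bndc//; exact: ig.
  rewrite -(@Rintegral_itvB _ g (BRight x) (BLeft z) y) ?bnd_simp//; last exact: ig.
  by rewrite addrC subrK.
by rewrite (H (Re \o f))// (H (Im \o f))// .
Qed.

Lemma eq_oint (x y : R) f g : (forall t, x < t < y -> f t = g t) ->
  oint x y f = oint x y g.
Proof.
move=> fg; rewrite /oint /cint; congr (_ +i* _); apply: eq_Rintegral => t;
by rewrite inE/= in_itv/= => /fg ->.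
Qed.

Lemma ointD (x y : R) f g : 0 <= x -> y <= tpi -> cbd f -> cbd g ->
  oint x y (fun t => f t + g t) = oint x y f + oint x y g.
Proof.
move=> x0 yT [rf if_] [rg ig]; rewrite /oint /cint.
have I h : bdm tpi h -> mu.-integrable `]x, y[ (EFin \o h).
  by move=> bh; apply: bdm_integrable bh _ _ => //; apply: subset_itv; rewrite bnd_simp.
apply/eqP; rewrite eq_complex /=; apply/andP; split; apply/eqP.
  under eq_Rintegral do rewrite raddfD/=.
  by rewrite (RintegralD _ (I _ rf) (I _ rg)).
under eq_Rintegral do rewrite raddfD/=.
by rewrite (RintegralD _ (I _ if_) (I _ ig)).
Qed.

Lemma ointZ (x y : R) c f : 0 <= x -> y <= tpi -> cbd f ->
  oint x y (fun t => c * f t) = c * oint x y f.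
Proof.
move=> x0 yT [rf if_]; rewrite /oint /cint.
have I h : bdm tpi h -> mu.-integrable `]x, y[ (EFin \o h).
  by move=> bh; apply: bdm_integrable bh _ _ => //; apply: subset_itv; rewrite bnd_simp.
have Z d h : bdm tpi h -> bdm tpi (fun t => d * h t).
  by move=> bh; apply: bdmM => //; exact: bdm_cst.
apply/eqP; rewrite eq_complex ReM ImM /=; apply/andP; split; apply/eqP.
  under eq_Rintegral do rewrite ReM.
  rewrite (RintegralB _ (I _ (Z (Re c) _ rf)) (I _ (Z (Im c) _ if_)))//.
  by rewrite (RintegralZl _ _ (I _ rf))// (RintegralZl _ _ (I _ if_))//.
under eq_Rintegral do rewrite ImM.
rewrite (RintegralD _ (I _ (Z (Re c) _ if_)) (I _ (Z (Im c) _ rf)))//.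
by rewrite (RintegralZl _ _ (I _ rf))// (RintegralZl _ _ (I _ if_))//.
Qed.

Lemma oint_sum (x y : R) n (f : nat -> R -> C) : 0 <= x -> y <= tpi ->
  (forall i, cbd (f i)) ->
  oint x y (fun t => \sum_(i < n) f i t) = \sum_(i < n) oint x y (f i).
Proof.
move=> x0 yT bf; elim: n => [|n IH].
  rewrite big_ord0 -[RHS](mul0r (oint x y (fun=> 1))).
  rewrite -ointZ//; last exact: cbd_cst.
  by apply: eq_oint => t _; rewrite big_ord0 mul0r.
rewrite big_ord_recr/= -IH -ointD//; last first.
  elim: n {IH} => [|n IH]; first by under eq_fun do rewrite big_ord0; exact: cbd_cst.
  by under eq_fun do rewrite big_ord_recr/=; exact: cbdD.
by apply: eq_oint => t _; rewrite big_ord_recr.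
Qed.

Lemma oint_scale (x y al be : R) f : 0 < al -> 0 <= al * x + be -> al * y + be <= tpi ->
  cbd f ->
  oint (al * x + be) (al * y + be) f =
  oint x y (fun t => al%:C * f (al * t + be)).
Proof.
move=> al0 x0 yT [rf if_]; rewrite /oint /cint.
have sub : `](al * x + be), (al * y + be)[ `<=` `[0, tpi].
  by apply: subset_itv; rewrite bnd_simp.
have H g : bdm tpi g -> \int[mu]_(u in `](al * x + be), (al * y + be)[) g u =
    \int[mu]_(u in `]x, y[) (al * g (al * u + be)).
  move=> [mg _]; rewrite (@Rintegral_affine _ al be) ?lt0r_neq0//; last first.
    exact: measurable_funS mg.
  rewrite gtr0_norm// /affine.
  rewrite (_ : _ @^-1` _ = `]x, y[%classic)//.
  by apply/seteqP; split=> u /=; rewrite !in_itv/= !ltrD2r !ltr_pM2l.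
apply/eqP; rewrite eq_complex /=; apply/andP; split; apply/eqP.
  rewrite (H (Re \o f))//; apply: eq_Rintegral => u _.
  by rewrite ReM/= mul0r subr0.
rewrite (H (Im \o f))//; apply: eq_Rintegral => u _.
by rewrite ImM/= mul0r addr0.
Qed.

Lemma oint_reflect (x y be : R) f : 0 <= be - y -> be - x <= tpi -> cbd f ->
  oint (be - y) (be - x) f = oint x y (fun t => f (be - t)).
Proof.
move=> x0 yT [rf if_]; rewrite /oint /cint.
have sub : `](be - y), (be - x)[ `<=` `[0, tpi].
  by apply: subset_itv; rewrite bnd_simp.
have H g : bdm tpi g -> \int[mu]_(u in `](be - y), (be - x)[) g u =
    \int[mu]_(u in `]x, y[) g (be - u).
  move=> [mg _]; rewrite (@Rintegral_affine _ (-1) be) ?oppr_eq0 ?oner_eq0//; last first.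
    exact: measurable_funS mg.
  rewrite normrN normr1 /affine.
  rewrite (_ : _ @^-1` _ = `]x, y[%classic)//; last first.
    by apply/seteqP; split=> u /=; rewrite !in_itv/= mulN1r (addrC _ be) !ltrD2l !ltrN2 andbC.
  by apply: eq_Rintegral => u _; rewrite mul1r mulN1r addrC.
by rewrite (H (Re \o f))// (H (Im \o f)).
Qed.
End ComplexIntegrals.

Section IteratedIntegrals.
Variable R : realType.
Local Notation C := R[i].
Local Notation mu := (@lebesgue_measure R).
Local Notation Re := (@complex.Re R).
Local Notation Im := (@complex.Im R).
Local Notation tpi := (2 * pi : R).

Lemma ae_affine (al be : R) (P : R -> Prop) : al != 0 ->
  {ae mu, forall x, P x} -> {ae mu, forall x, P (al * x + be)}.
Proof.
move=> al0 [N [mN muN PN]]; have mphi := measurable_affine al be.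
exists (affine al be @^-1` N); split.
- by rewrite -[X in measurable X]setTI; exact: mphi.
- have := affine_measure be al0 mN; rewrite muN /pushforward/mscale/= => /eqP.
  by rewrite mule_eq0 eqe normr_eq0 (negbTE al0) => /eqP.
- by move=> x nPx; apply: PN => Px; exact: nPx.
Qed.

Lemma ae_neq (c : R) : {ae mu, forall x, x != c}.
Proof.
exists [set c]; split => //; first exact: lebesgue_measure_set1.
by move=> x /= /negP; rewrite negbK => /eqP.
Qed.

Lemma normc2 (z : C) : Normc.normc (2 * z) = 2 * Normc.normc z.
Proof.
rewrite Normc.normcM (_ : 2 = (2 : R)%:C); last by rewrite rmorph_nat.
by rewrite /= expr0n /= addr0 sqrtr_sqr ger0_norm.
Qed.

Lemma normcN (z : C) : Normc.normc (- z) = Normc.normc z.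
Proof. by case: z => x y /=; rewrite !sqrrN. Qed.

Lemma cmeas_periodize (f : R -> C) : cmeasurable f -> cmeasurable (periodize f).
Proof.
have mp : measurable_fun setT
    (fun x : R => x - tpi * (Num.ceil (x / tpi) - 1)%:~R : R).
  apply: measurable_funB => //; apply: measurable_funM => //.
  apply: nondecreasing_measurable => // x y xy.
  rewrite ler_int lerD2r; apply: le_ceil.
  by rewrite ler_pM2r// invr_gt0 tpi_gt0.
by move=> [rf if_]; split; exact: (measurableT_comp (f := _ \o f)).
Qed.

Lemma cmeas_affine (f : R -> C) (al be : R) : cmeasurable f ->
  cmeasurable (fun x => f (al * x + be)).
Proof.
move=> [rf if_].
have m : measurable_fun setT (fun x : R => al * x + be : R).
  by apply: measurable_funD => //; exact: measurable_funM.
by split; exact: (measurableT_comp (f := _ \o f)).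
Qed.

Lemma ReZ (c : R) (z : C) : Re (c%:C * z) = c * Re z.
Proof. by case: z => x y /=; rewrite mul0r subr0. Qed.
Lemma ImZ (c : R) (z : C) : Im (c%:C * z) = c * Im z.
Proof. by case: z => x y /=; rewrite mul0r addr0. Qed.

Lemma cmeas_scale (f : R -> C) (c : R) : cmeasurable f ->
  cmeasurable (fun x => c%:C * f x).
Proof.
move=> [rf if_]; split.
  rewrite (_ : _ \o _ = fun x => c * (Re \o f) x); first exact: measurable_funM.
  by apply/funext => x; exact: ReZ.
rewrite (_ : _ \o _ = fun x => c * (Im \o f) x); first exact: measurable_funM.
by apply/funext => x; exact: ImZ.
Qed.

Lemma cmeas_if (f g : R -> C) (c : R) : cmeasurable f -> cmeasurable g ->
  cmeasurable (fun x => if x <= c then f x else g x).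
Proof.
have mc : measurable_fun setT (fun x : R => x <= c) by exact: measurable_fun_ler.
move=> [rf if_] [rg ig]; split.
  rewrite (_ : _ \o _ = fun x => if x <= c then (Re \o f) x else (Re \o g) x).
    exact: measurable_fun_ifT.
  by apply/funext => x /=; case: ifP.
rewrite (_ : _ \o _ = fun x => if x <= c then (Im \o f) x else (Im \o g) x).
  exact: measurable_fun_ifT.
by apply/funext => x /=; case: ifP.
Qed.

Lemma in_X_concat (a b : nat -> R -> C) : in_X a -> in_X b -> in_X (concat_fun a b).
Proof.
have e2 : 2 = (2 : R)%:C :> C by rewrite rmorph_nat.
move=> [pa ma [la la0 aB]] [pb mb [lb lb0 bB]]; split.
- by move=> k x; exact: periodize_period.
- move=> k; apply: cmeas_periodize; rewrite e2; apply: cmeas_if; apply: cmeas_scale.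
    by rewrite (_ : (fun t => _) = (fun t => a k (2 * t + 0))); [exact: cmeas_affine|apply/funext => t; rewrite addr0].
  exact: cmeas_affine.
exists (2 * (la + lb)); first by rewrite mulr_gt0// addr_gt0.
move=> k.
have lel (l z : R) : 0 < l -> l <= la + lb -> z <= l ^+ k.+1 ->
    2 * z <= (2 * (la + lb)) ^+ k.+1.
  move=> l0 ll zl; apply: (@le_trans _ _ (2 ^+ k.+1 * l ^+ k.+1)); last first.
    rewrite exprMn ler_pM2l ?exprn_gt0//.
    by rewrite lerXn2r// nnegrE// ?addr_ge0// ltW.
  apply: (@le_trans _ _ (2 * l ^+ k.+1)); first by rewrite ler_pM2l.
  by rewrite ler_pM2r ?exprn_gt0// exprS ler_peMr// exprn_ege1// ler1n.
have two0 : (2 : R) != 0 by [].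
have aeab := aeS2 (fun x => @conj _ _) (ae_affine 0 two0 (aB k))
                                       (ae_affine (- tpi) two0 (bB k)).
apply: aeS2 (ae_neq 0) aeab => x x0 [Ha Hb] /andP[x0' xT].
have x_gt0 : 0 < x by rewrite lt_neqAle eq_sym x0.
rewrite ?/concat_fun ?/inverse_fun periodize_id ?x_gt0//.
case: (leP x pi) => xpi; rewrite normc2.
  apply: (lel la) => //; first by rewrite lerDl ltW.
  rewrite -[2 * x]addr0; apply: Ha; rewrite addr0 mulr_ge0//=.
  by rewrite ler_pM2l.
apply: (lel lb) => //; first by rewrite lerDr ltW.
apply: Hb; apply/andP; split; first by rewrite subr_ge0 ler_pM2l// ltW.
by rewrite lerBlDr -mulr2n -(mulr_natl tpi) ler_pM2l.
Qed.

Lemma cmeas_opp (f : R -> C) : cmeasurable f -> cmeasurable (fun x => - f x).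
Proof.
move=> mf; rewrite (_ : (fun x => _) = fun x => (-1)%:C * f x).
  exact: cmeas_scale.
by apply/funext => x; rewrite rmorphN rmorph1 mulN1r.
Qed.

Lemma in_X_inverse (a : nat -> R -> C) : in_X a -> in_X (inverse_fun a).
Proof.
move=> [pa ma [l l0 aB]]; split.
- by move=> k x; exact: periodize_period.
- move=> k; apply/cmeas_periodize/cmeas_opp.
  rewrite (_ : (fun t => _) = fun t => a k (-1 * t + tpi)).
    exact: cmeas_affine.
  by apply/funext => t; rewrite mulN1r addrC.
exists l => // k.
have two0 : -1 != 0 :> R by rewrite oppr_eq0 oner_eq0.
apply: aeS2 (ae_neq 0) (ae_affine tpi two0 (aB k)).
move=> x x0 Ha /andP[x0' xT].
have x_gt0 : 0 < x by rewrite lt_neqAle eq_sym x0.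
rewrite ?/concat_fun ?/inverse_fun periodize_id ?x_gt0// normcN.
move: Ha; rewrite mulN1r addrC; apply.
by rewrite subr_ge0 xT/= gerBl.
Qed.

Lemma in_X_zero : in_X (fun _ _ => 0 : C).
Proof.
split => //; first by move=> k; split; exact: measurable_cst.
exists 1 => // k.
have H (x : R) : 0 <= x <= tpi -> Normc.normc (0 : C) <= 1 ^+ k.+1.
  by move=> _; rewrite Normc.normc0 expr1n.
exact: aeT H.
Qed.

Lemma in_X_cbd (a : nat -> R -> C) k : in_X a -> cbd (a k).
Proof.
move=> [_ ma [l l0 aB]]; have [rf if_] := ma k; split; split.
- exact: measurable_funTS.
- exists (l ^+ k.+1); apply: aeS (aB k) => x H /H; exact/le_trans/Re_le_normc.
- exact: measurable_funTS.
- exists (l ^+ k.+1); apply: aeS (aB k) => x H /H; exact/le_trans/Im_le_normc.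
Qed.

Lemma iter_int_rcons (a : nat -> R -> C) w k t : iter_int a (rcons w k) t =
  cint `[0, t] (fun s => a k s * iter_int a w s).
Proof. by rewrite /iter_int -cats1 foldl_cat. Qed.

Lemma cbd_iter (a : nat -> R -> C) w : in_X a -> cbd (iter_int a w).
Proof.
move=> Xa; elim/last_ind: w => [|w k IH]; first exact: cbd_cst.
have := cbd_int (cbdM (in_X_cbd k Xa) IH).
by congr cbd; apply/funext => t; rewrite iter_int_rcons.
Qed.

Lemma cbd_step (a : nat -> R -> C) w k : in_X a -> cbd (fun s => a k s * iter_int a w s).
Proof. by move=> Xa; apply: cbdM; [exact: in_X_cbd|exact: cbd_iter]. Qed.

Lemma iter_int_oint (a : nat -> R -> C) w k t : in_X a -> 0 <= t <= tpi ->
  iter_int a (rcons w k) t = oint 0 t (fun s => a k s * iter_int a w s).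
Proof. by move=> Xa tT; rewrite iter_int_rcons cint_oint//; exact: cbd_step. Qed.

Lemma iter_int_cat (a : nat -> R -> C) w k s t : in_X a -> 0 <= s -> s <= t -> t <= tpi ->
  iter_int a (rcons w k) t =
  iter_int a (rcons w k) s + oint s t (fun u => a k u * iter_int a w u).
Proof.
move=> Xa s0 st tT.
rewrite (@iter_int_oint a w k t)// ?(le_trans s0 st)//.
rewrite (@iter_int_oint a w k s)// ?s0 ?(le_trans st tT)//.
by rewrite -oint_cat//; exact: cbd_step.
Qed.

Lemma iter_int0 (a : nat -> R -> C) k w : iter_int a (rcons w k) 0 = 0.
Proof.
by rewrite iter_int_rcons /cint set_itv1 !Rintegral_set1.
Qed.

Let pi_ge0 : 0 <= (pi : R). Proof. exact: pi_ge0. Qed.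
Let pi_le : (pi : R) <= tpi. Proof. by rewrite mulr_natl mulr2n lerDr pi_ge0. Qed.

Lemma concat_left (a b : nat -> R -> C) w t : in_X a -> in_X b -> 0 <= t <= pi ->
  iter_int (concat_fun a b) w t = iter_int a w (2 * t).
Proof.
move=> Xa Xb; elim/last_ind: w t => [//|w k IH] t /andP[t0 tpi'].
rewrite (iter_int_oint _ _ (in_X_concat Xa Xb)); last first.
  by rewrite t0 (le_trans tpi').
rewrite (iter_int_oint _ _ Xa); last by rewrite mulr_ge0//= ler_pM2l.
have := @oint_scale _ 0 t 2 0 _ _ _ _ (cbd_step w k Xa).
rewrite mulr0 !addr0 => -> //; last by rewrite ler_pM2l.
apply: eq_oint => s /andP[s0 st].
have spi : s <= pi by rewrite (le_trans (ltW st)).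
rewrite IH ?spi ?ltW// /concat_fun periodize_id ?s0 ?(le_trans spi)//= ?spi.
by rewrite addr0 mulrA; congr (_ * _ * _); rewrite rmorph_nat.
Qed.

Lemma concat_right (a b : nat -> R -> C) w t : in_X a -> in_X b -> pi <= t <= tpi ->
  iter_int (concat_fun a b) w t =
  \sum_(i < (size w).+1) total_int a (take i w) *
                         iter_int b (drop i w) (2 * t - tpi).
Proof.
move=> Xa Xb; elim/last_ind: w t => [|w k IH] t /andP[pit tT].
  by rewrite big_ord_recr big_ord0 /= add0r mul1r.
have tb : 0 <= 2 * t - tpi <= tpi.
  apply/andP; split; first by rewrite subr_ge0 ler_pM2l.
  by rewrite lerBlDr -mulr2n -(mulr_natl tpi) ler_pM2l.
rewrite (iter_int_cat w k (in_X_concat Xa Xb) pi_ge0 pit tT).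
rewrite concat_left ?pi_ge0 ?lexx//.
rewrite size_rcons big_ord_recr/= take_oversize ?size_rcons// drop_oversize ?size_rcons//= mulr1.
rewrite addrC; congr (_ + _).
pose F u := \sum_(i < (size w).+1)
   total_int a (take i w) * (b k u * iter_int b (drop i w) u).
have cF i : cbd (fun u => total_int a (take i w) * (b k u * iter_int b (drop i w) u)).
  by apply: cbdM; [exact: cbd_cst|exact: cbd_step].
have cFs : cbd F.
  rewrite /F; elim: (size w).+1 => [|n IHn].
    by under eq_fun do rewrite big_ord0; exact: cbd_cst.
  by under eq_fun do rewrite big_ord_recr/=; exact: cbdD.
transitivity (oint pi t (fun s => (2 : R)%:C * F (2 * s + - tpi))).
  apply: eq_oint => s /andP[pis st].
  have sT : s <= tpi by rewrite (le_trans (ltW st)).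
  have s0 : 0 < s by rewrite (le_lt_trans _ pis).
  rewrite IH ?sT ?ltW// /concat_fun periodize_id ?s0 ?sT//= leNgt pis/=.
  rewrite /F !mulr_sumr; apply: eq_bigr => i _.
  rewrite rmorph_nat; ring.
have /andP[tb0 tbT] := tb.
have := @oint_scale _ pi t 2 (- tpi) _ _ _ _ cFs.
rewrite subrr => <- //.
rewrite (@oint_sum _ 0 _ _ (fun i u =>
  total_int a (take i w) * (b k u * iter_int b (drop i w) u)))//; apply: eq_bigr => i _.
have iw : (i <= size w)%N by rewrite -ltnS.
rewrite ointZ//; last exact: cbd_step.
by rewrite -iter_int_oint// -drop_rcons// -cats1 takel_cat.
Qed.

Lemma total_int_concat (a b : nat -> R -> C) w : in_X a -> in_X b ->
  total_int (concat_fun a b) w =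
  \sum_(i < (size w).+1) total_int a (take i w) * total_int b (drop i w).
Proof.
move=> Xa Xb; rewrite /total_int concat_right// ?lexx ?andbT//.
by apply: eq_bigr => i _; congr (_ * iter_int _ _ _); ring.
Qed.

(* the concatenation of [a] with its inverse is odd about [pi], hence its
   iterated integrals are even about [pi] *)
Lemma loop_odd (a : nat -> R -> C) k t : in_X a -> 0 < t < pi ->
  concat_fun a (inverse_fun a) k (tpi - t) = - concat_fun a (inverse_fun a) k t.
Proof.
move=> Xa /andP[t0 tpi'].
have tT : t <= tpi by rewrite ltW// (lt_le_trans tpi').
have pit : pi < tpi - t by rewrite ltrBrDr mulr_natl mulr2n ltrD2l.
rewrite /concat_fun !periodize_id ?t0 ?tT//; last first.
  by rewrite (lt_trans _ pit) ?pi_gt0//= gerBl ltW.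
rewrite /= (ltW tpi') leNgt pit /= /inverse_fun periodize_id.
  by rewrite mulrN; congr (- (_ * a k _)); ring.
by apply/andP; split; lra.
Qed.

Lemma loop_even (a : nat -> R -> C) w t : in_X a -> 0 <= t <= pi ->
  iter_int (concat_fun a (inverse_fun a)) w (tpi - t) =
  iter_int (concat_fun a (inverse_fun a)) w t.
Proof.
move=> Xa; have Xc := in_X_concat Xa (in_X_inverse Xa).
elim/last_ind: w t => [//|w k IH] t /andP[t0 tpi'].
have h1 : pi <= tpi - t by lra.
have h2 : tpi - t <= tpi by lra.
rewrite (iter_int_cat w k Xc t0 (le_trans tpi' h1) h2).
rewrite -[RHS]addr0; congr (_ + _).
rewrite (oint_cat t0 tpi' h1 h2 (cbd_step w k Xc)).
have := @oint_reflect _ t pi tpi _ _ _ (cbd_step w k Xc).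
rewrite (_ : tpi - pi = pi); last by ring.
have pi0 := pi_ge0.
move=> ->; [|lra|lra].
rewrite [X in _ + X](_ : _ = -1 * oint t pi
    (fun u => concat_fun a (inverse_fun a) k u *
              iter_int (concat_fun a (inverse_fun a)) w u)).
  by rewrite mulN1r subrr.
rewrite -ointZ//; last exact: cbd_step.
apply: eq_oint => u /andP[tu upi].
have u0 : 0 < u by rewrite (le_lt_trans t0).
by rewrite loop_odd ?u0// IH ?(ltW u0) ?(ltW upi)// mulN1r mulNr.
Qed.

Lemma total_int_loop (a : nat -> R -> C) w : in_X a -> w != [::] ->
  total_int (concat_fun a (inverse_fun a)) w = 0.
Proof.
move=> Xa; case/lastP: w => [//|w k] _.
by rewrite /total_int -[tpi]subr0 loop_even ?lexx ?pi_ge0// iter_int0.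
Qed.



End IteratedIntegrals.

Section Convolution.
Variable K : comPzRingType.
Implicit Types A B D : seq nat -> K.

Definition wconv A B (w : seq nat) : K :=
  \sum_(i < (size w).+1) A (take i w) * B (drop i w).

Lemma wconv_nil A B : wconv A B [::] = A [::] * B [::].
Proof. by rewrite /wconv big_ord_recl big_ord0 addr0. Qed.

Lemma wconv_cons A B x w :
  wconv A B (x :: w) = A [::] * B (x :: w) + wconv (A \o cons x) B w.
Proof. by rewrite /wconv big_ord_recl. Qed.

Lemma wconvDl A A' B w : wconv (fun u => A u + A' u) B w = wconv A B w + wconv A' B w.
Proof. by rewrite /wconv -big_split; apply: eq_bigr => i _; rewrite mulrDl. Qed.

Lemma wconvZl c A B w : wconv (fun u => c * A u) B w = c * wconv A B w.
Proof. by rewrite /wconv mulr_sumr; apply: eq_bigr => i _; rewrite mulrA. Qed.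

Lemma wconvA A B D w : wconv A (wconv B D) w = wconv (wconv A B) D w.
Proof.
elim: w A B => [|x w IH] A B; first by rewrite !wconv_nil mulrA.
rewrite !wconv_cons wconv_nil IH -mulrA mulrDr -addrA; congr (_ + _).
rewrite -wconvZl -wconvDl; congr wconv; apply/funext => u /=.
by rewrite wconv_cons.
Qed.

Definition wconv1 (w : seq nat) : K := (w == [::])%:R.

Lemma wconv1l A w : wconv wconv1 A w = A w.
Proof.
rewrite /wconv big_ord_recl take0 drop0 /wconv1 eqxx mul1r big1 ?addr0// => i _.
by rewrite /bump/=; case: w i => [[]|x w i]//=; rewrite mul0r.
Qed.

Lemma wconv1r A w : wconv A wconv1 w = A w.
Proof.
rewrite /wconv big_ord_recr/= take_size drop_size /wconv1 eqxx mulr1.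
rewrite big1 ?add0r// => i _.
by rewrite -size_eq0 size_drop subn_eq0 leqNgt ltn_ord mulr0.
Qed.

End Convolution.

Section Group.
Variable R : realType.
Local Notation C := R[i].
Local Notation mu := (@lebesgue_measure R).
Local Notation Re := (@complex.Re R).
Local Notation Im := (@complex.Im R).
Local Notation tpi := (2 * pi : R).

Record X := MkX { X_fun :> nat -> R -> C ; _ : in_X X_fun }.

HB.instance Definition _ := gen_eqMixin X.
HB.instance Definition _ := gen_choiceMixin X.

Lemma XP (a : X) : in_X a. Proof. by case: a. Qed.

Definition concatX (a b : X) : X := MkX (in_X_concat (XP a) (XP b)).
Definition inverseX (a : X) : X := MkX (in_X_inverse (XP a)).
Definition zeroX : X := MkX (@in_X_zero R).

Definition in_U (a : X) := forall w, w != [::] -> total_int a w = 0.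

Definition simX (a b : X) : bool := `[< in_U (concatX a (inverseX b)) >].

Let total_nil (a : X) : total_int a [::] = 1. Proof. by []. Qed.

Lemma total_concat (a b : X) :
  total_int (concatX a b) = wconv (total_int a) (total_int b).
Proof. by apply/funext => w; exact: total_int_concat (XP a) (XP b). Qed.

Let in_UE (a : X) : in_U a <-> total_int a = @wconv1 C.
Proof.
split=> [Ua|Ua w /negbTE w0]; last by rewrite Ua /wconv1 w0.
apply/funext => w; rewrite /wconv1; have [->//|/Ua ->//] := eqVneq w [::].
Qed.

Lemma total_inverse (a : X) :
  wconv (total_int a) (total_int (inverseX a)) = @wconv1 C.
Proof.
rewrite -total_concat; apply/in_UE => w w0; exact: total_int_loop (XP a) w0.
Qed.

Lemma total_inverse_l (a : X) :
  wconv (total_int (inverseX a)) (total_int a) = @wconv1 C.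
Proof.
have -> : total_int a = total_int (inverseX (inverseX a)).
  apply/funext => w; rewrite -[LHS]wconv1r -(total_inverse (inverseX a)).
  rewrite -[RHS]wconv1l -(total_inverse a).
  exact: wconvA.
exact: total_inverse.
Qed.

Lemma simXP (a b : X) : reflect (total_int a = total_int b) (simX a b).
Proof.
apply: (iffP (asboolP _)) => [/in_UE|ab]; last first.
  by apply/in_UE; rewrite total_concat ab total_inverse.
rewrite total_concat => ab; apply/funext => w.
rewrite -[LHS]wconv1r -(total_inverse_l b) wconvA ab; exact: wconv1l.
Qed.

Lemma simX_refl : reflexive simX. Proof. by move=> a; exact/simXP. Qed.

Lemma simX_sym : symmetric simX.
Proof. by move=> a b; apply/idP/idP => /simXP ab; exact/simXP/esym. Qed.

Lemma simX_trans : transitive simX.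
Proof. by move=> b a c /simXP ab /simXP bc; apply/simXP; rewrite ab. Qed.

Canonical simX_equiv := EquivRel simX simX_refl simX_sym simX_trans.

Definition G : Type := {eq_quot simX}.
HB.instance Definition _ := Choice.on G.
HB.instance Definition _ := EqQuotient.on G.

Definition classG (a : X) : G := \pi_G a.

Lemma classGP (a b : X) : reflect (classG a = classG b) (simX a b).
Proof. exact: eqmodP. Qed.

Lemma reprGK : cancel repr classG. Proof. exact: reprK. Qed.

Definition mulG (g h : G) : G := classG (concatX (repr g) (repr h)).
Definition invG (g : G) : G := classG (inverseX (repr g)).
Definition oneG : G := classG zeroX.

Let total_repr (a : X) : total_int (repr (classG a)) = total_int a.
Proof. by apply/simXP/classGP; rewrite reprGK. Qed.

Lemma mulGE (a b : X) : mulG (classG a) (classG b) = classG (concatX a b).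
Proof. by apply/classGP/simXP; rewrite !total_concat !total_repr. Qed.

Let total_inv_uniq (a b : X) : total_int a = total_int b ->
  total_int (inverseX a) = total_int (inverseX b).
Proof.
move=> ab; apply/funext => w.
rewrite -[LHS]wconv1r -(total_inverse b) -ab wconvA total_inverse_l; exact: wconv1l.
Qed.

Lemma invGE (a : X) : invG (classG a) = classG (inverseX a).
Proof. by apply/classGP/simXP/total_inv_uniq; exact: total_repr. Qed.

Let total_zero : total_int zeroX = @wconv1 C.
Proof.
apply/in_UE => w; case/lastP: w => [//|w k] _.
rewrite /total_int iter_int_rcons /cint.
under eq_Rintegral do rewrite mul0r.
by under [X in _ +i* X]eq_Rintegral do rewrite mul0r; rewrite !Rintegral_cst// !mul0r.
Qed.

Let GP (g : G) : exists a, g = classG a.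
Proof. by exists (repr g); rewrite reprGK. Qed.

Lemma mulGA : associative mulG.
Proof.
move=> g h k; have [a ->] := GP g; have [b ->] := GP h; have [d ->] := GP k.
rewrite !mulGE; apply/classGP/simXP; rewrite !total_concat.
by apply/funext => w; exact: wconvA.
Qed.

Lemma mul1G : left_id oneG mulG.
Proof.
move=> g; have [a ->] := GP g; rewrite mulGE; apply/classGP/simXP.
by rewrite total_concat total_zero; apply/funext => w; exact: wconv1l.
Qed.

Lemma mulG1 : right_id oneG mulG.
Proof.
move=> g; have [a ->] := GP g; rewrite mulGE; apply/classGP/simXP.
by rewrite total_concat total_zero; apply/funext => w; exact: wconv1r.
Qed.

Lemma mulVG : left_inverse oneG invG mulG.
Proof.
move=> g; have [a ->] := GP g; rewrite invGE mulGE; apply/classGP/simXP.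
by rewrite total_concat total_zero total_inverse_l.
Qed.

Lemma mulGV : right_inverse oneG invG mulG.
Proof.
move=> g; have [a ->] := GP g; rewrite invGE mulGE; apply/classGP/simXP.
by rewrite total_concat total_zero total_inverse.
Qed.

HB.instance Definition _ := isGroup.Build G mulGA mul1G mulG1 mulVG mulGV.

(* [s] is the sum of the series of the [u k]. *)
Definition csum_to (u : nat -> C) (s : C) :=
  (fun n => Re (\sum_(k < n) u k)) @ \oo --> Re s /\
  (fun n => Im (\sum_(k < n) u k)) @ \oo --> Im s.

Definition is_cderive (v : R -> C) (x : R) (d : C) :=
  is_derive x 1 (Re \o v) (Re d) /\ is_derive x 1 (Im \o v) (Im d).

(* [v] is a Lipschitz solution on [0, 2 pi] of
   dv/dx = sum_(i >= 1) a_i(x) v^(i+1) a.e., with v(0) = r; only the values of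
   [v] on [0, 2 pi] matter. *)
Definition is_solution (a : X) (r : C) (v : R -> C) :=
  [/\ v 0 = r,
      exists L : R, forall x y, 0 <= x <= tpi -> 0 <= y <= tpi ->
        Normc.normc (v x - v y) <= L * `|x - y| &
      {ae mu, forall x, 0 < x < tpi -> exists2 d : C,
        is_cderive v x d & csum_to (fun k => a k x * v x ^+ k.+2) d}].

(* The Poincare map P(a)(r) = v(2 pi; r; a). For small [r] the solution exists
   and is unique on [0, 2 pi], so the choice made by [xget] is harmless there;
   for other [r] the value is irrelevant. *)
Definition first_return (a : X) (r : C) : C :=
  xget (fun=> 0) [set v | is_solution a r v] tpi.

(* P(a)(r) = r as germs at r = 0. *)
Definition trivial_return (a : X) := exists2 rho : R, 0 < rho &
  forall r : C, Normc.normc r < rho -> first_return a r = r.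

(* The tuple [i] lists i_1 - 1, .., i_k - 1, with i_1 + .. + i_k = n. *)
Definition c_coef (n : nat) (a : X) : C :=
  \sum_(1 <= k < n.+1)
    \sum_(i : k.-tuple 'I_n | (\sum_(j < k) (tnth i j).+1)%N == n)
      (\prod_(j < k)
         ((n - \sum_(m < k | (m <= j)%N) (tnth i m).+1) + 1)%N)%:R *
      total_int a [seq val m | m <- i].

Definition c_hat (n : nat) (g : G) : C := c_coef n (repr g).

Lemma c_hatE n (a : X) : c_hat n (classG a) = c_coef n a.
Proof.
rewrite /c_hat /c_coef; apply: eq_bigr => k _; apply: eq_bigr => i _.
by rewrite total_repr.
Qed.

Definition C_hat : set G := [set classG a | a in [set a | trivial_return a]].

Definition coset_C_hat (g : G) : set G := [set (g * h)%g | h in C_hat].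

(* The quotient G / C_hat, as the type of cosets of [C_hat] in [G]. *)
Record Q := MkQ { Q_set :> set G ; _ : exists g, Q_set = coset_C_hat g }.

Definition projQ (g : G) : Q := MkQ (ex_intro _ g erefl).

End Group.

(* Main.v *)
Require Import Defs.
From mathcomp Require Import all_boot all_order all_algebra.
From mathcomp Require Import complex.
From mathcomp Require Import all_classical all_reals all_analysis measurable_realfun.
From mathcomp Require Import ring lra zify.
Set Implicit Arguments.
Unset Strict Implicit.
Unset Printing Implicit Defensive.
Import Order.TTheory GRing.Theory Num.Theory.
Import numFieldNormedType.Exports.
Import ComplexField.
Local Open Scope classical_set_scope.
Local Open Scope ring_scope.

(** Write [P(a)(r) = r + sum_(n >= 1) c_n(a) r^(n+1)].  Two facts give the result:
    multiplying [g] by a class with trivial return does not change [c_n], and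
    the unit class has trivial return, so that [g] belongs to its own coset.
    If [g] and [h] have the same coset, then [g = h k] with [k] of trivial
    return, hence [c_n(g) = c_n(h)]; the function on the quotient then exists
    and is unique because the projection is onto.

    Algebra.  The product in front of the iterated integral of a word in [c_n]
    is the case [m = 1] of a product [word_coef m] which records how
    [d(v^m)/dx = m sum_(k >= 1) a_k v^(m+k)] raises the exponent letter by letter.
    The sums [word_sum m n] of all words of weight [n] against [word_coef m]
    are the coefficients of [r^(m+n)] in [P(a)^m].  For a concatenation, whose
    iterated integrals are convolutions of those of the two factors,
    [word_sum_wconv] is composition of power series: [P(a * b)] arises by
    substituting [P(b)] into [P(a)].  When all [c_j(b)] vanish only the term
    [c_n(a)] is left.

    Analysis.  Trivial return makes every [c_n] vanish.  If [P(a)(r) = r] for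
    all small [r], then for each small [r <> 0] there is a Lipschitz solution
    [v] with [v(0) = v(2 pi) = r].  Its values stay within [2 |r|]
    ([solution_le]), and integrating the equation for [v^m] repeatedly gives
    [v(x)^m = sum_(n < d) pow_coef m n x r^(m+n) + O(|r|^(m+d))] with a
    constant that depends on neither [r] nor [v] ([solution_pow_expansion]).
    For [m = 1] and [x = 2 pi] this says that the power series with
    coefficients [c_n] vanishes to every order at [0].

    The bound and the expansion both integrate an almost everywhere derivative
    of a Lipschitz function.  [lipschitz_FTC_le] does this in the form that the estimates use:
    if the derivative is almost everywhere within [E] of a bounded measurable
    [g], then the increment of the function is within [E T] of the integral of
    [g]. *)

(** * Words and composition of power series *)

Definition weight (w : seq nat) : nat := sumn [seq k.+1 | k <- w].

Lemma weight_cat u w : weight (u ++ w) = (weight u + weight w)%N.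
Proof. by rewrite /weight map_cat sumn_cat. Qed.

Lemma weight_rcons w k : weight (rcons w k) = (weight w + k.+1)%N.
Proof. by rewrite -cats1 weight_cat /weight /= addn0. Qed.

(** A word of weight [n + 1] comes from one of weight [n] either by adding a
    new letter [0] in front or by increasing the first letter; this avoids a
    recursion over all smaller weights. *)
Fixpoint words (n : nat) : seq (seq nat) :=
  if n is p.+1 then
    [seq 0%N :: w | w <- words p] ++
    [seq (head 0%N w).+1 :: behead w | w <- words p & w != [::]]
  else [:: [::]].

Lemma mem_words n w : (w \in words n) = (weight w == n).
Proof.
elim: n w => [|n IH] [|[|k] w] //=.
- rewrite mem_cat; apply/negbTE/norP; split; apply/mapP => -[] //.
- rewrite mem_cat mem_map ?IH; last by move=> ? ? [].
  by rewrite orbC (_ : _ \in _ = false) //; apply/mapP => -[].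
- rewrite mem_cat orbC; transitivity (k :: w \in words n); last by rewrite IH.
  rewrite [X in _ || X](_ : _ = false) ?orbF; last by apply/mapP => -[].
  apply/mapP/idP => [[[|j u]]|kw].
  + by rewrite mem_filter.
  + by rewrite mem_filter /= => h [-> ->].
  + by exists (k :: w) => //; rewrite mem_filter.
Qed.

Lemma uniq_words n : uniq (words n).
Proof.
elim: n => [//|n IH] /=; rewrite cat_uniq map_inj_uniq ?IH; last by move=> ? ? [].
rewrite map_inj_in_uniq ?filter_uniq// ?andbT /=.
  by apply/hasPn => _ /mapP[w _ ->]; apply/mapP => -[].
move=> [|i u] [|j w]; rewrite !mem_filter //= => _ _ [-> ->] //.
Qed.

(** The last letter belongs to the outermost integration; removing it is one
    step back in the differential equation. *)
Lemma words_rcons n :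
  perm_eq (words n.+1) [seq rcons w k | k <- iota 0 n.+1, w <- words (n - k)].
Proof.
apply: uniq_perm; first exact: uniq_words.
  apply: allpairs_uniq_dep; first exact: iota_uniq.
    by move=> k _; exact: uniq_words.
  move=> _ _ /allpairsPdep[k [w [_ _ ->]]] /allpairsPdep[j [u [_ _ ->]]] /=.
  by move=> /rcons_inj[-> ->].
move=> w; rewrite mem_words; apply/eqP/allpairsPdep.
  case/lastP: w => [//|w k]; rewrite weight_rcons addnS => -[wk].
  exists k, w; split=> //; first by rewrite mem_iota ltnS -wk leq_addl.
  by rewrite mem_words -wk addnK.
move=> [k [u [+ + ->]]]; rewrite mem_iota add0n ltnS mem_words weight_rcons /=.
by move=> kn /eqP ->; rewrite addnS subnK.
Qed.

(** Read from the last letter, the exponent of [v] starts at [m] and each letter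
    [k] multiplies by the current exponent and raises it by [k + 1]; a letter
    therefore contributes [m] plus the weight of the letters that follow it. *)
Fixpoint word_coef (m : nat) (w : seq nat) : nat :=
  if w is _ :: w' then ((m + weight w') * word_coef m w')%N else 1%N.

Lemma word_coef_rcons m w k : word_coef m (rcons w k) = (m * word_coef (m + k.+1) w)%N.
Proof.
elim: w => [|j w IH] /=; first by rewrite addn0.
by rewrite IH weight_rcons; lia.
Qed.

Lemma sum_triangle (K : pzRingType) d (F : nat -> nat -> K) :
  \sum_(k < d) \sum_(n < d - k) F k n = \sum_(n < d) \sum_(k < n.+1) F k (n - k)%N.
Proof.
elim: d => [|d IH]; first by rewrite !big_ord0.
rewrite [RHS]big_ord_recr /= -IH big_ord_recr /= subSnn big_ord1.
rewrite [X in _ = _ + X]big_ord_recr /= subnn addrA -big_split /=; congr (_ + _).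
by apply: eq_bigr => k _; rewrite subSn ?big_ord_recr//= ltnW.
Qed.

Section WordSum.
Variable K : comPzRingType.
Implicit Types A B F : seq nat -> K.

Definition word_sum (m n : nat) F : K := \sum_(w <- words n) (word_coef m w)%:R * F w.

Lemma word_sum0 m F : word_sum m 0 F = F [::].
Proof. by rewrite /word_sum /= big_seq1 mul1r. Qed.

(** One application of the equation for [v^m]: the last letter [k], which stands
    for the coefficient of [v^(k+2)], turns [v^m] into [m v^(m+k+1)]. *)
Lemma word_sumS m n F : word_sum m n.+1 F =
  m%:R * \sum_(k < n.+1) word_sum (m + k.+1) (n - k) (fun w => F (rcons w k)).
Proof.
rewrite /word_sum (perm_big _ (words_rcons n)) big_allpairs_dep /= mulr_sumr.
rewrite -(big_mkord xpredT (fun k : nat => m%:R *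
  \sum_(w <- words (n - k)) (word_coef (m + k.+1) w)%:R * F (rcons w k))).
rewrite /index_iota subn0; apply: eq_bigr => k _; rewrite mulr_sumr.
by apply: eq_bigr => w _; rewrite word_coef_rcons natrM mulrA.
Qed.

Lemma eq_word_sum m n F A : (forall w, F w = A w) -> word_sum m n F = word_sum m n A.
Proof. by move=> FA; apply: eq_bigr => w _; rewrite FA. Qed.

Lemma word_sumD m n F A :
  word_sum m n (fun w => F w + A w) = word_sum m n F + word_sum m n A.
Proof. by rewrite /word_sum -big_split; apply: eq_bigr => w _; rewrite mulrDr. Qed.

Lemma word_sumZr m n F c : word_sum m n (fun w => F w * c) = word_sum m n F * c.
Proof. by rewrite /word_sum mulr_suml; apply: eq_bigr => w _; rewrite mulrA. Qed.

Lemma wconv_rcons A B w k : wconv A B (rcons w k) =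
  wconv A (fun u => B (rcons u k)) w + A (rcons w k) * B [::].
Proof.
rewrite /wconv size_rcons big_ord_recr /= take_oversize ?drop_oversize ?size_rcons//.
congr (_ + _); apply: eq_bigr => i _.
have iw : (i <= size w)%N by rewrite -ltnS.
by rewrite -drop_rcons// -cats1 takel_cat.
Qed.

(** Composition of power series: the exponent reached after the word of [B],
    which is read first, is the starting exponent for the word of [A].  The
    induction removes the last letter; a word whose [B]-part is empty accounts
    for the term [j = 0]. *)
Lemma word_sum_wconv m n A B : word_sum m n (wconv A B) =
  \sum_(j < n.+1) word_sum m j B * word_sum (m + j) (n - j) A.
Proof.
elim/ltn_ind: n m A B => -[|n] IH m A B.
  by rewrite big_ord1 !word_sum0 wconv_nil mulrC.
pose G k j := word_sum (m + k.+1) j (fun w => B (rcons w k)) *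
              word_sum (m + (k + j).+1) (n - (k + j)) A.
have step (k : 'I_n.+1) :
    word_sum (m + k.+1) (n - k) (fun w => wconv A B (rcons w k)) =
    \sum_(j < n.+1 - k) G k j +
    word_sum (m + k.+1) (n - k) (fun w => A (rcons w k)) * B [::].
  rewrite (eq_word_sum _ _ (fun w => wconv_rcons A B w k)) word_sumD word_sumZr.
  have kn : (k <= n)%N by rewrite -ltnS.
  rewrite IH ?ltnS ?leq_subr// subSn//; congr (_ + _); apply: eq_bigr => j _.
  by rewrite /G subnDA -addnA addSn.
rewrite word_sumS (eq_bigr _ (fun k _ => step k)) big_split /= sum_triangle.
rewrite -mulr_suml mulrDr mulrA -word_sumS.
rewrite [RHS]big_ord_recl word_sum0 addn0 subn0 addrC (mulrC (B _)).
congr (_ + _); rewrite mulr_sumr; apply: eq_bigr => j _.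
rewrite lift0 word_sumS -mulrA mulr_suml; congr (_ * _); apply: eq_bigr => k _.
by rewrite /G subnKC // -ltnS.
Qed.

End WordSum.

(** * The coefficients of the first return map as sums over words *)

(** With [n] the weight of [w], the weight of the letters after position [j] is
    [n] minus that of the letters up to [j], as in the formula for [c_n]. *)
Lemma word_coef_prod p w : word_coef p w =
  (\prod_(j < size w) ((weight w - \sum_(i < size w | i <= j) (nth 0 w i).+1) + p))%N.
Proof.
elim: w => [|x w IH] /=; first by rewrite big_ord0.
have s0 (j : nat) : (\sum_(i < (size w).+1 | i <= j) (nth 0 (x :: w) i).+1)%N =
    (x.+1 + \sum_(i < size w | i < j) (nth 0 w i).+1)%N.
  by rewrite big_mkcond big_ord_recl /= -big_mkcond.
rewrite big_ord_recl IH s0 [X in (_ - (_ + X))%N]big1 ?addn0; last by [].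
rewrite /weight /= addKn addnC; congr (_ * _)%N.
by apply: eq_bigr => j _; rewrite [X in _ = (_ - X + _)%N](s0 j.+1) subnDl.
Qed.

Lemma nth_lt_weight w i : (i < size w)%N -> (nth 0 w i < weight w)%N.
Proof.
elim: w i => [//|x w IH] [|i] /=; first by rewrite /weight /=; lia.
by move=> /IH; rewrite /weight /=; lia.
Qed.

Lemma size_le_weight w : (size w <= weight w)%N.
Proof. by elim: w => [//|x w IH]; rewrite /weight /=; move: IH; rewrite /weight; lia. Qed.

(** A word of weight [n > 0] has between [1] and [n] letters, all below [n], so
    the tuples in the formula for [c_n] are exactly the words of weight [n]. *)
Lemma words_tuples n : (1 <= n)%N ->
  perm_eq (words n) [seq [seq nat_of_ord m | m <- i] | k : nat <- index_iota 1 n.+1,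
     i : k.-tuple 'I_n <- [seq i : k.-tuple 'I_n <- index_enum (k.-tuple 'I_n) |
       (\sum_(j < k) (tnth i j).+1)%N == n]].
Proof.
move=> n1.
have wE k (i : k.-tuple 'I_n) :
    (\sum_(j < k) (tnth i j).+1)%N = weight [seq val m | m <- i].
  rewrite /weight -map_comp sumnE big_map.
  by rewrite big_tuple.
apply: uniq_perm; first exact: uniq_words.
  apply: allpairs_uniq_dep; first exact: iota_uniq.
    by move=> k _; rewrite filter_uniq // index_enum_uniq.
  move=> _ _ /allpairsPdep[k [w [_ _ ->]]] /allpairsPdep[j [u [_ _ ->]]] /=.
  move=> wu; have kj : k = j by rewrite -(size_tuple w) -(size_tuple u) -!(size_map val) wu.
  subst j; congr existT; apply/val_inj/(inj_map val_inj); exact: wu.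
move=> w; rewrite mem_words; apply/eqP/allpairsPdep.
  move=> wn; have sw i : (i < size w)%N -> (nth 0 w i < n)%N by rewrite -wn; exact: nth_lt_weight.
  case: n n1 wE wn sw => [//|n] _ wE wn sw.
  have we : w = [seq val m | m <- [tuple inord (nth 0 w j) : 'I_n.+1 | j < size w]].
    apply: (@eq_from_nth _ 0); first by rewrite size_map size_tuple.
    move=> i iw; rewrite (nth_map ord0) ?size_tuple//.
    by have := tnth_nth ord0 [tuple inord (nth 0 w j) : 'I_n.+1 | j < size w] (Ordinal iw);
      rewrite tnth_mktuple /= => <-; rewrite inordK// sw.
  exists (size w), [tuple inord (nth 0 w j) : 'I_n.+1 | j < size w]; split => //.
    rewrite mem_index_iota ltnS -wn size_le_weight andbT.
    by case: (w) wn.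
  by rewrite mem_filter mem_index_enum andbT wE -we wn.
by move=> [k [i [_ + ->]]]; rewrite mem_filter wE => /andP[/eqP].
Qed.

Lemma c_coef_word_sum (R : realType) n (a : X R) : (1 <= n)%N ->
  c_coef n a = word_sum 1 n (total_int a).
Proof.
move=> n1; rewrite /word_sum (perm_big _ (words_tuples n1)) big_allpairs_dep /=.
apply: eq_bigr => k _; rewrite big_filter; apply: eq_bigr => i /eqP wi.
rewrite word_coef_prod size_map size_tuple; congr (_%:R * _).
have nthE (j : 'I_k) : nth 0%N [seq val m | m <- i] j = tnth i j.
  by rewrite (tnth_nth (tnth i j)) (nth_map (tnth i j)) ?size_tuple.
have -> : weight [seq val m | m <- i] = n.
  by rewrite -[RHS]wi /weight -map_comp sumnE big_map big_tuple.
apply: eq_bigr => j _; congr ((_ - _) + _)%N.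
by apply: eq_bigr => m _; rewrite nthE.
Qed.

(** * Integrating the derivative of a Lipschitz function *)

Section LipschitzFTC.
Variable R : realType.
Local Notation mu := (@lebesgue_measure R).

Definition lip_real (T L : R) (f : R -> R) :=
  forall x y, 0 <= x <= T -> 0 <= y <= T -> `|f x - f y| <= L * `|x - y|.

(** Retraction of the line onto [0, T]; composing with it extends a Lipschitz
    function on [0, T] to the line with the same constant. *)
Definition clamp (T x : R) : R := Num.min (Num.max x 0) T.

Lemma clamp_itv (T x : R) : 0 <= T -> 0 <= clamp T x <= T.
Proof.
by move=> T0; rewrite /clamp ge_min lexx orbT le_min T0 le_max lexx orbT.
Qed.

Lemma clamp_id (T x : R) : 0 <= x <= T -> clamp T x = x.
Proof. by move=> /andP[x0 xT]; rewrite /clamp max_l// min_l. Qed.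

Lemma clamp_ge (T x : R) : 0 <= T -> T <= x -> clamp T x = T.
Proof. by move=> T0 Tx; rewrite /clamp max_l ?(le_trans T0)// min_r. Qed.

Lemma clamp_lip (T x y : R) : `|clamp T x - clamp T y| <= `|x - y|.
Proof.
wlog xy : x y / y <= x.
  by move=> H; case: (leP y x) => [/H//|/ltW /H]; rewrite distrC (distrC y).
have le1 (u v z : R) : v <= u -> 0 <= Num.max u z - Num.max v z <= u - v.
  by move=> vu; case: (leP u z) => ?; case: (leP v z) => ?; apply/andP; split; lra.
have le2 (u v z : R) : v <= u -> 0 <= Num.min u z - Num.min v z <= u - v.
  by move=> vu; case: (leP u z) => ?; case: (leP v z) => ?; apply/andP; split; lra.
have /andP[h1 h2] := le1 _ _ 0 xy.
have h3 : Num.max y 0 <= Num.max x 0 by rewrite -subr_ge0.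
have /andP[h4 h5] := le2 _ _ T h3.
rewrite /clamp ger0_norm// ger0_norm ?subr_ge0//; exact: le_trans h5 h2.
Qed.

Lemma lipschitz_continuous (L : R) (f : R -> R) :
  (forall x y, `|f x - f y| <= L * `|x - y|) -> continuous f.
Proof.
move=> fL x; apply/cvgrPdist_le => e e0.
have L0 : 0 < `|L| + 1 by rewrite ltr_wpDl.
near=> y; apply: le_trans (fL _ _) _.
apply: (@le_trans _ _ ((`|L| + 1) * `|x - y|)).
  by rewrite ler_wpM2r// ler_wpDr// ler_norm.
rewrite -ler_pdivlMl//; near: y; apply: cvgr_dist_le; first exact: cvg_id.
by rewrite mulr_gt0// invr_gt0.
Unshelve. all: by end_near. Qed.

Lemma is_derive_cvg_quot (f : R -> R) (x d : R) (h : nat -> R) :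
  is_derive x 1 f d -> h @ \oo --> 0 -> (forall n, h n != 0) ->
  (fun n => (h n)^-1 * (f (h n + x) - f x)) @ \oo --> d.
Proof.
move=> [df <-] h0 hn.
have hd : h @ \oo --> 0^'.
  move=> A; rewrite /dnbhs /= => A0.
  have H : \forall n \near \oo, h n != 0 -> A (h n) by exact: h0 _ A0.
  by apply: filterS H => n; apply; exact: hn.
have := cvg_comp _ _ hd df.
rewrite /derive /comp /= => H; apply: cvg_trans H.
by apply: near_eq_cvg; apply: nearW => n /=; rewrite /GRing.scale /= mulr1.
Qed.

Lemma Rint_cat (f : R -> R) (a b c : R) : a <= b -> b <= c ->
  mu.-integrable `[a, c] (EFin \o f) ->
  \int[mu]_(x in `[a, c]) f x = \int[mu]_(x in `[a, b]) f x + \int[mu]_(x in `[b, c]) f x.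
Proof.
move=> ab bc If.
rewrite -[X in _ = _ + X]Rintegral_itv_obnd_cbnd; last first.
  by apply: integrableS If => //; apply: subset_itv; rewrite bnd_simp.
by rewrite -(@Rintegral_itvB _ f (BLeft a) (BRight c) b) ?bnd_simp// addrC subrK.
Qed.

Lemma bdm_norm (T : R) (f : R -> R) : bdm T f -> bdm T (fun x => `|f x|).
Proof.
move=> [mf [M fM]]; split; first exact: measurableT_comp.
by exists M; apply: aeS fM => x fM xT; rewrite normr_id fM.
Qed.

Lemma fine_mu_itv (a b : R) : a <= b -> fine (mu `[a, b]) = b - a.
Proof.
rewrite lebesgue_measure_itv /= lte_fin => ab; case: ltP => [_|ba]; first by rewrite -EFinD.
by rewrite (le_anti (introT andP (conj ab ba))) subrr.
Qed.

Section FTC.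
Variables (T L E : R) (f g : R -> R).
Hypotheses (T0 : 0 < T) (E0 : 0 <= E) (fL : lip_real T L f) (bg : bdm T g).
Hypothesis fg : {ae mu, forall x, 0 < x < T ->
  exists2 d, is_derive x 1 f d & `|d - g x| <= E}.

Let F x := f (clamp T x).
Let h (n : nat) : R := n.+1%:R^-1.
Let q n x := (h n)^-1 * (F (h n + x) - F x).

Let h0 n : 0 < h n. Proof. by rewrite invr_gt0. Qed.

Let L0 : 0 <= L.
Proof.
have := @fL 0 T; rewrite !lexx (ltW T0) => /(_ isT isT) H.
have := le_trans (normr_ge0 _) H.
by rewrite pmulr_lge0// normr_gt0 subr_eq0 eq_sym gt_eqF.
Qed.

Let FL x y : `|F x - F y| <= L * `|x - y|.
Proof.
apply: le_trans (fL (clamp_itv _ (ltW T0)) (clamp_itv _ (ltW T0))) _.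
by rewrite ler_wpM2l// clamp_lip.
Qed.

Let mF : measurable_fun setT F.
Proof. by apply: continuous_measurable_fun; exact: (@lipschitz_continuous L F FL). Qed.

Let mFs (c : R) : measurable_fun setT (fun x => F (c + x)).
Proof.
apply: (@measurableT_comp _ _ _ _ _ _ F) => //; exact: measurable_funD.
Qed.

Let F_le x : `|F x| <= `|f 0| + L * T.
Proof.
have T0' := ltW T0; have cl := clamp_itv x T0'.
rewrite -[F x](subrK (f 0)) (le_trans (ler_normD _ _))// addrC lerD2l.
apply: le_trans (fL cl _) _; first by rewrite lexx.
by move: cl => /andP[c0 cT]; rewrite subr0 ger0_norm// ler_wpM2l.
Qed.

Let bdmFs (c S : R) : bdm S (fun x => F (c + x)).
Proof.
split; first exact: measurable_funTS.
by exists (`|f 0| + L * T); apply: aeT => x _.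
Qed.

Let bdmF (S : R) : bdm S F.
Proof. by have := bdmFs 0 S; under eq_fun do rewrite add0r. Qed.

Let mq n : measurable_fun setT (q n).
Proof. by apply: measurable_funM => //; exact: measurable_funB. Qed.

Let q_le n x : `|q n x| <= L.
Proof.
rewrite /q normrM gtr0_norm ?invr_gt0//.
rewrite -ler_pdivlMl ?invr_gt0// invrK mulrC (le_trans (FL _ _))//.
by rewrite addrK gtr0_norm.
Qed.

Let bq n : bdm T (q n).
Proof.
split; first exact: measurable_funTS.
by exists L; apply: aeT => x _.
Qed.

(* The part of the error of the difference quotient that exceeds [E]; it tends
   to 0 almost everywhere, and [E + W n] bounds the whole error; dominated
   convergence is thus applied with the limit 0 instead of the derivative. *)
Let W n x := Num.max (`|q n x - g x| - E) 0.

Let W0 n x : 0 <= W n x. Proof. by rewrite le_max lexx orbT. Qed.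

Let W_cvg : {ae mu, forall x, `[0, T]%classic x -> W ^~ x @ \oo --> 0}.
Proof.
apply: aeS2 _ (ae_neq T) (aeS2 (fun x => @conj _ _) (ae_neq 0) fg).
move=> x xT [x0] + /=; rewrite in_itv /= => H /andP[x0' xT'].
have [|d df dg] := H; first by rewrite !lt_neqAle x0' xT' xT eq_sym x0.
have hc : h @ \oo --> 0 by exact: cvg_harmonic.
have hT : \forall n \near \oo, h n <= T - x.
  by apply: (@cvgr_le R nat \oo _ h 0 hc (T - x)); rewrite subr_gt0 lt_neqAle xT.
have qd : q ^~ x @ \oo --> d.
  have := is_derive_cvg_quot df hc (fun n => lt0r_neq0 (h0 n)).
  apply: cvg_trans; apply: near_eq_cvg; near=> n.
  rewrite /q /F !clamp_id ?x0'//; apply/andP; split.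
    by rewrite addr_ge0// ltW.
  rewrite -lerBrDr; near: n; exact: hT.
apply/cvgrPdist_le => e e0; near=> n.
have qde : `|d - q n x| <= e by near: n; exact: cvgr_dist_le qd _ e0.
rewrite sub0r normrN ger0_norm ?W0// ge_max (ltW e0) andbT.
rewrite lerBlDr (le_trans _ (lerD qde dg))// (distrC d (q n x)).
exact: ler_distD.
Unshelve. all: by end_near. Qed.

Let mW n : measurable_fun `[0, T] (W n).
Proof.
apply: measurable_maxr => //; apply: measurable_funB => //.
apply: measurableT_comp => //; apply: measurable_funB => //.
- exact: measurable_funTS.
- by case: bg.
Qed.

Let W_int : (fun n => \int[mu]_(x in `[0, T]) W n x) @ \oo --> 0.
Proof.
have [mg [M gM]] := bg.
have [] := @dominated_convergence _ _ _ mu `[0, T]%classic (measurable_itv _) (fun n => EFin \o W n)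
  (cst 0%E) (cst (L + `|M|)%:E).
- by move=> n; apply/measurable_EFinP; exact: mW.
- exact: measurable_cst.
- apply: aeS W_cvg => x H /H Wx; apply: cvg_EFin; first exact: nearW.
  exact: Wx.
- apply: (@bdm_integrable _ T (cst (L + `|M|))) => //; exact: bdm_cst.
- apply: aeS gM => x H n /=; rewrite in_itv /= => /H gx.
  rewrite lee_fin ger0_norm ?W0// ge_max addr_ge0// andbT.
  rewrite lerBlDr -[leLHS]addr0 lerD// (le_trans (ler_normB _ _))// lerD//.
  exact: le_trans gx (ler_norm _).
by move=> _ _; rewrite integral0 => /fine_cvg.
Qed.

(* The mean difference quotient telescopes to the difference of the means of [F]
   over [T, T + h] and [0, h], where the first one equals [f T]. *)
Let q_int n : `|\int[mu]_(x in `[0, T]) q n x - (f T - f 0)| <= L * h n.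
Proof.
have hn := h0 n; have hn0 := lt0r_neq0 hn; have Th : 0 <= T + h n by rewrite addr_ge0 ?ltW.
have IF : mu.-integrable `[0, T + h n] (EFin \o F).
  by apply: (bdm_integrable (bdmF (T + h n))).
have IFs a b : 0 <= a -> b <= T + h n -> mu.-integrable `[a, b] (EFin \o F).
  by move=> a0 bT; apply: integrableS IF => //; apply: subset_itv; rewrite bnd_simp.
have shift : \int[mu]_(x in `[0, T]) F (h n + x) = \int[mu]_(x in `[h n, T + h n]) F x.
  rewrite [RHS](@Rintegral_affine _ 1 (h n))//; last exact: measurable_funTS.
  rewrite /affine (_ : _ @^-1` _ = `[0, T]%classic); last first.
    by apply/seteqP; split=> x /=; rewrite !in_itv /= mul1r lerD2r lerDr.
  by apply: eq_Rintegral => x _; rewrite normr1 !mul1r addrC.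
have c1 := Rint_cat (ltW hn) (_ : h n <= T + h n) IF.
have c2 := Rint_cat (ltW T0) (_ : T <= T + h n) IF.
have e1 : \int[mu]_(x in `[T, T + h n]) F x = f T * h n.
  rewrite -[RHS](_ : \int[mu]_(x in `[T, T + h n]) (f T) = _).
    apply: eq_Rintegral => x; rewrite inE /= in_itv /= => /andP[Tx _].
    by rewrite /F clamp_ge// ltW.
  rewrite Rintegral_cst// fine_mu_itv ?lerDl ?ltW//; ring.
have e2 : `|\int[mu]_(x in `[0, h n]) F x - f 0 * h n| <= L * h n * h n.
  have Ih : mu.-integrable `[0, h n] (EFin \o F) by apply: IFs; rewrite ?lerDr// ltW.
  have Ic (c S : R) : mu.-integrable `[0, S] (EFin \o cst c).
    by apply: (bdm_integrable (bdm_cst S c)).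
  have muh (S : R) : 0 < S -> fine (mu `[0, S]) = S.
    by move=> S0; rewrite fine_mu_itv ?subr0// ltW.
  rewrite -[X in f 0 * X](muh (h n))// -Rintegral_cst// -RintegralB//; last exact: Ic.
  apply: le_trans (le_normr_Rintegral _ _) _ => //.
    by apply: (bdm_integrable (bdmB (bdmF (h n)) (bdm_cst (h n) (f 0)))).
  rewrite -[X in _ <= _ * X](muh (h n))// -Rintegral_cst//; apply: le_Rintegral => //.
    by apply: (bdm_integrable (bdm_norm (bdmB (bdmF (h n)) (bdm_cst (h n) (f 0))))).
    exact: Ic.
  move=> x /=; rewrite in_itv /= => /andP[x0 xh].
  have -> : f 0 = F 0 by rewrite /F clamp_id// lexx ltW.
  by rewrite (le_trans (FL _ _))// subr0 ger0_norm// ler_wpM2l.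
have I0 : mu.-integrable `[0, T] (EFin \o F).
  by apply: IFs => //; rewrite lerDl ltW.
have Ish : mu.-integrable `[0, T] (EFin \o (fun x => F (h n + x))).
  by apply: (bdm_integrable (bdmFs (h n) T)).
rewrite /q RintegralZl//; last first.
  by apply: (bdm_integrable (bdmB (bdmFs (h n) T) (bdmF T))).
rewrite RintegralB// shift.
have -> : \int[mu]_(x in `[h n, T + h n]) F x - \int[mu]_(x in `[0, T]) F x =
   f T * h n - \int[mu]_(x in `[0, h n]) F x.
  have := c1 _; have := c2 _; rewrite lerDl lerDr !ltW// => /(_ isT) + /(_ isT).
  by rewrite e1; lra.
move: e2; set I := Rintegral _ _ _ => e2.
have -> : (h n)^-1 * (f T * h n - I) - (f T - f 0) = - ((h n)^-1 * (I - f 0 * h n)).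
  by field.
by rewrite normrN normrM gtr0_norm ?invr_gt0// ler_pdivrMl// (mulrC (h n) (L * h n)).
Qed.

(** The difference quotients of a Lipschitz function are uniformly bounded, so
    dominated convergence lets their integrals, which tend to [f T - f 0], be
    compared with the integral of [g]. *)
Lemma lipschitz_FTC_le : `|f T - f 0 - \int[mu]_(x in `[0, T]) g x| <= E * T.
Proof.
have I n : bdm T n -> mu.-integrable `[0, T] (EFin \o n).
  by move=> bn; exact: bdm_integrable bn _ _.
have H n : `|f T - f 0 - \int[mu]_(x in `[0, T]) g x| <=
    E * T + (\int[mu]_(x in `[0, T]) W n x + L * h n).
  have bqg : bdm T (fun x => `|q n x - g x|) by apply/bdm_norm/bdmB.
  have bW : bdm T (W n).
    split; first exact: mW.
    have [_ [M gM]] := bqg; exists `|M|; apply: aeS gM => x H /H.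
    rewrite normr_id => qM; rewrite ger0_norm ?W0// ge_max normr_ge0 andbT.
    by rewrite lerBlDr ler_wpDr// (le_trans qM) ?ler_norm.
  have qg : `|\int[mu]_(x in `[0, T]) q n x - \int[mu]_(x in `[0, T]) g x| <=
      E * T + \int[mu]_(x in `[0, T]) W n x.
    rewrite -RintegralB//; try exact: I.
    apply: le_trans (le_normr_Rintegral _ _) _ => //; first exact: I (bdmB (bq n) bg).
    rewrite -[X in _ * X](subr0 T) -(fine_mu_itv (ltW T0)) -Rintegral_cst// -RintegralD//.
    - apply: le_Rintegral => //; [exact: I|exact: I (bdmD (bdm_cst T E) bW)|].
      by move=> x _; rewrite -lerBlDl le_max lexx.
    - exact: I (bdm_cst T E).
    - exact: I.
  apply: le_trans (ler_distD (\int[mu]_(x in `[0, T]) q n x) _ _) _.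
  by rewrite addrA [leRHS]addrC lerD// distrC.
apply: (@cvgr_to_ge _ _ _ _ _ _ _ (_ : (fun n => E * T + (\int[mu]_(x in `[0, T]) W n x + L * h n)) @ \oo --> _)).
  rewrite -[X in _ --> X]addr0 -[X in _ --> _ + X]addr0.
  apply: cvgD; first exact: cvg_cst.
  apply: cvgD; first exact: W_int.
  rewrite -[X in _ --> X](mulr0 L); apply: cvgM; first exact: cvg_cst.
  exact: cvg_harmonic.
exact: nearW.
Qed.

End FTC.

End LipschitzFTC.

(** * Lipschitz curves in the complex plane *)

Section ComplexLipschitz.
Variable R : realType.
Local Notation C := R[i].
Local Notation mu := (@lebesgue_measure R).
Local Notation Re := (@complex.Re R).
Local Notation Im := (@complex.Im R).
Local Notation tpi := (2 * pi : R).
Local Notation normc := (@Normc.normc R).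

Lemma normc_ge0 (z : C) : 0 <= normc z.
Proof. by case: z => x y; exact: sqrtr_ge0. Qed.

Lemma normcX (z : C) n : normc (z ^+ n) = normc z ^+ n.
Proof.
elim: n => [|n IH]; first by rewrite !expr0 Normc.normc1.
by rewrite !exprS Normc.normcM IH.
Qed.

Lemma normcD (x y : C) : normc (x + y) <= normc x + normc y.
Proof. by rewrite -lecR rmorphD; exact: (ler_normD x y). Qed.

Lemma normc_sum (I : Type) (s : seq I) (F : I -> C) :
  normc (\sum_(i <- s) F i) <= \sum_(i <- s) normc (F i).
Proof.
elim: s => [|i s IH]; first by rewrite !big_nil Normc.normc0.
by rewrite !big_cons (le_trans (normcD _ _))// lerD2l.
Qed.

Lemma normc_nat n : normc n%:R = n%:R.
Proof.
have -> : n%:R = (n%:R : R)%:C%C :> C by rewrite rmorph_nat.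
by rewrite /= expr0n /= addr0 sqrtr_sqr ger0_norm.
Qed.

Lemma normc_le_ReIm (z : C) (B : R) : `|Re z| <= B -> `|Im z| <= B -> normc z <= 2 * B.
Proof.
move=> zr zi; have B0 := le_trans (normr_ge0 _) zr.
case: z zr zi => x y /= xB yB.
rewrite -(ger0_norm (mulr_ge0 _ B0))// -sqrtr_sqr ler_wsqrtr//.
have := ler_pM (normr_ge0 _) (normr_ge0 _) xB xB.
have := ler_pM (normr_ge0 _) (normr_ge0 _) yB yB.
rewrite -!expr2 !real_normK ?num_real// => h1 h2.
by have := sqr_ge0 B; rewrite exprMn; lra.
Qed.

Lemma csum_le (u : nat -> C) (s c : C) (B : R) d : csum_to u s ->
  (forall n, (d <= n)%N -> normc (\sum_(k < n) u k - c) <= B) ->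
  normc (s - c) <= 2 * B.
Proof.
move=> [us vs] H.
have lim_le (f : nat -> R) (y z : R) : f @ \oo --> y ->
    (forall n, (d <= n)%N -> `|f n - z| <= B) -> `|y - z| <= B.
  move=> fy fB.
  have fz : (fun n => f n - z) @ \oo --> y - z by apply: cvgB fy _; exact: cvg_cst.
  have nz : (fun n => `|f n - z|) @ \oo --> `|y - z| by exact: (cvg_norm fz).
  by apply: (cvgr_to_le nz); exists d => // n; exact: fB.
apply: normc_le_ReIm; rewrite raddfB /=; apply: lim_le; [exact: us| |exact: vs|];
  move=> n /H; apply: le_trans; rewrite -raddfB.
  exact: Re_le_normc.
exact: Im_le_normc.
Qed.

Lemma is_cderiveM (u w : R -> C) (x : R) (d e : C) :
  is_cderive u x d -> is_cderive w x e ->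
  is_cderive (fun t => u t * w t) x (u x * e + w x * d).
Proof.
move=> [ru iu] [rw iw]; split.
  have -> : Re \o (fun t => u t * w t) =
      (Re \o u) * (Re \o w) - (Im \o u) * (Im \o w).
    by apply/funext => t; rewrite !fctE; exact: Defs.ReM.
  apply: is_derive_eq; rewrite !raddfD /= !Defs.ReM /GRing.scale /=; ring.
have -> : Im \o (fun t => u t * w t) =
      (Re \o u) * (Im \o w) + (Im \o u) * (Re \o w).
  by apply/funext => t; rewrite !fctE; exact: Defs.ImM.
apply: is_derive_eq; rewrite !raddfD /= !Defs.ImM /GRing.scale /=; ring.
Qed.

Lemma is_cderiveX (u : R -> C) (x : R) (d : C) n : is_cderive u x d ->
  is_cderive (fun t => u t ^+ n.+1) x (n.+1%:R * u x ^+ n * d).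
Proof.
move=> ud; elim: n => [|n IH].
  by rewrite expr0 !mul1r; under eq_fun do rewrite expr1.
under eq_fun do rewrite exprS; have := is_cderiveM ud IH.
by congr is_cderive; rewrite exprS -[in RHS]natr1; ring.
Qed.

Definition lip_curve (T L : R) (u : R -> C) :=
  forall x y, 0 <= x <= T -> 0 <= y <= T -> normc (u x - u y) <= L * `|x - y|.

Lemma lip_curveX (T L s : R) (u : R -> C) n : lip_curve T L u ->
  (forall x, 0 <= x <= T -> normc (u x) <= s) ->
  exists L', lip_curve T L' (fun x => u x ^+ n).
Proof.
move=> uL us; elim: n => [|n [M IH]].
  by exists 0 => x y _ _; rewrite !expr0 subrr Normc.normc0 mul0r.
exists (s * M + L * s ^+ n) => x y xT yT; rewrite !exprS.
have -> : u x * u x ^+ n - u y * u y ^+ n =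
    u x * (u x ^+ n - u y ^+ n) + (u x - u y) * u y ^+ n by ring.
rewrite (le_trans (normcD _ _))// !Normc.normcM normcX mulrDl -mulrA [X in _ <= _ + X]mulrAC.
apply: lerD; apply: ler_pM; rewrite ?normc_ge0 ?exprn_ge0 ?normc_ge0 ?us ?IH ?uL//.
by rewrite lerXn2r ?nnegrE ?normc_ge0 ?us// (le_trans (normc_ge0 _) (us _ yT)).
Qed.

Lemma bdm_le (S T : R) (f : R -> R) : S <= T -> bdm T f -> bdm S f.
Proof.
move=> ST [mf [M fM]]; split.
  by apply: measurable_funS mf => //; apply: subset_itvl; rewrite bnd_simp.
exists M; apply: aeS fM => x + /andP[x0 xS].
by rewrite x0 (le_trans xS ST); apply.
Qed.

(** The real estimate applied to the real and the imaginary part; the factor 2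
    comes from bounding the modulus by both parts. *)
Lemma lip_curve_FTC_le (T x L E : R) (u G : R -> C) : 0 <= x <= T -> 0 <= E ->
  lip_curve T L u -> bdm T (Re \o G) -> bdm T (Im \o G) ->
  {ae mu, forall t, 0 < t < T ->
    exists2 d : C, is_cderive u t d & normc (d - G t) <= E} ->
  normc (u x - u 0 - cint `[0, x] G) <= 2 * (E * T).
Proof.
move=> /andP[x0 xT] E0 uL bR bI uG.
have [->|xn0] := eqVneq x 0.
  rewrite subrr sub0r normcN /cint set_itv1 !Rintegral_set1 Normc.normc0.
  by rewrite !mulr_ge0// (le_trans x0 xT).
have {xn0} x_gt0 : 0 < x by rewrite lt_neqAle eq_sym xn0.
have xTt (t : R) : 0 <= t <= x -> 0 <= t <= T.
  by move=> /andP[t0 tx]; rewrite t0 (le_trans tx).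
have real_part (P : {additive C -> R}) : (forall z, `|P z| <= normc z) ->
    (forall t d, is_cderive u t d -> is_derive t 1 (P \o u) (P d)) ->
    bdm T (P \o G) ->
    `|P (u x) - P (u 0) - \int[mu]_(t in `[0, x]) P (G t)| <= E * T.
  move=> Pn Pd bP; apply: (@le_trans _ _ (E * x)); last by rewrite ler_wpM2l.
  apply: (@lipschitz_FTC_le R x L E (P \o u) (P \o G)) => //.
  - move=> t s tx sx; rewrite /= -raddfB (le_trans (Pn _))//.
    by apply: uL; exact: xTt.
  - exact: bdm_le bP.
  - apply: aeS uG => t H /andP[t0 tx].
    have [|d du dG] := H; first by rewrite t0 (lt_le_trans tx).
    by exists (P d); [exact: Pd|rewrite /= -raddfB (le_trans (Pn _))].
apply: normc_le_ReIm; rewrite !raddfB /=.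
  by apply: (real_part (@complex.Re R)) => //; [exact: Re_le_normc|move=> t d []].
by apply: (real_part (@complex.Im R)) => //; [exact: Im_le_normc|move=> t d []].
Qed.

End ComplexLipschitz.

(** * Solutions with small initial value *)

Section SmallSolutions.
Variable R : realType.
Local Notation C := R[i].
Local Notation mu := (@lebesgue_measure R).
Local Notation Re := (@complex.Re R).
Local Notation Im := (@complex.Im R).
Local Notation tpi := (2 * pi : R).
Local Notation normc := (@Normc.normc R).

Lemma geom_sum_le2 (q : R) n : 0 <= q -> 2 * q <= 1 -> \sum_(i < n) q ^+ i <= 2.
Proof.
move=> q0 q1; elim: n => [|n IH]; first by rewrite big_ord0.
rewrite big_ord_recl expr0; under eq_bigr do rewrite exprS.
by rewrite -mulr_sumr; have := ler_wpM2l q0 IH; lra.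
Qed.

Lemma power_tail_le (c : nat -> C) (z : C) (l s : R) d n :
  0 <= l -> 2 * (l * s) <= 1 -> (forall k, normc (c k) <= l ^+ k.+1) -> normc z <= s ->
  (d <= n)%N ->
  normc (\sum_(k < n) c k * z ^+ k.+2 - \sum_(k < d) c k * z ^+ k.+2) <=
  2 * (l ^+ d.+1 * s ^+ d.+2).
Proof.
move=> l0 ls cl zs /subnKC <-; move: (n - d)%N => j.
have s0 : 0 <= s by rewrite (le_trans (normc_ge0 _) zs).
rewrite big_split_ord /= addrAC subrr add0r.
apply: le_trans (normc_sum _ _) _.
apply: (@le_trans _ _ (\sum_(i < j) l ^+ d.+1 * s ^+ d.+2 * (l * s) ^+ i)).
  apply: ler_sum => i _; rewrite Normc.normcM normcX.
  have -> : l ^+ d.+1 * s ^+ d.+2 * (l * s) ^+ i = l ^+ (d + i).+1 * s ^+ (d + i).+2.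
    by rewrite exprMn mulrACA -!exprD.
  apply: ler_pM; rewrite ?normc_ge0 ?exprn_ge0 ?normc_ge0//.
  by rewrite lerXn2r ?nnegrE ?normc_ge0.
have c0 : 0 <= l ^+ d.+1 * s ^+ d.+2 by apply: mulr_ge0; exact: exprn_ge0.
rewrite -mulr_sumr [leRHS]mulrC ler_wpM2l//.
by apply: geom_sum_le2 => //; rewrite mulr_ge0.
Qed.

Variables (a : X R) (l : R).
Hypotheses (l0 : 0 < l) (al : {ae mu, forall x, 0 <= x <= tpi ->
  forall k, normc (a k x) <= l ^+ k.+1}).

(** As long as [l s <= 1 / 2] the series of the equation is dominated by a
    geometric one, so each partial sum approximates the derivative. *)
Lemma solution_field_le (r : C) (v : R -> C) (T s : R) : is_solution a r v ->
  T <= tpi -> (forall x, 0 <= x <= T -> normc (v x) <= s) -> 2 * (l * s) <= 1 ->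
  {ae mu, forall x, 0 < x < T -> exists2 d : C, is_cderive v x d &
    forall j, normc (d - \sum_(k < j) a k x * v x ^+ k.+2) <= 4 * (l ^+ j.+1 * s ^+ j.+2)}.
Proof.
move=> [_ _ vd] TT vs ls; apply: aeS2 al vd => x ax H /andP[x0 xT].
have [|d dv ds] := H; first by rewrite x0 (lt_le_trans xT).
have {}vs : normc (v x) <= s by apply: vs; rewrite !ltW.
have {}ax k : normc (a k x) <= l ^+ k.+1.
  by apply: ax; rewrite ltW//= ltW// (lt_le_trans xT).
exists d => // j.
have -> (y : R) : 4 * y = 2 * (2 * y) by ring.
apply: (csum_le (d := j) ds) => n jn.
exact: power_tail_le (ltW l0) ls ax vs jn.
Qed.

(** While [|v| <= 2 |r|], the derivative is [O(|r|^2)], so that over the whole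
    circle [v] moves away from [r] by at most [|r| / 2]. *)
Lemma solution_le_three_halves (r : C) (v : R -> C) (T : R) : is_solution a r v ->
  64 * (l * normc r * tpi) <= 1 -> 4 * (l * normc r) <= 1 ->
  0 <= T -> T <= tpi -> (forall x, 0 <= x <= T -> normc (v x) <= 2 * normc r) ->
  2 * normc (v T) <= 3 * normc r.
Proof.
move=> sv r1 r2 T0 TT vT; have [v0 [L vL] _] := sv.
have rho0 := normc_ge0 r.
have ls : 2 * (l * (2 * normc r)) <= 1 by move: r2; rewrite (mulrCA l); lra.
have vd := solution_field_le sv TT vT ls.
have E0 : 0 <= 4 * (l ^+ 1 * (2 * normc r) ^+ 2).
  by rewrite mulr_ge0// mulr_ge0 ?exprn_ge0 ?mulr_ge0// ltW.
have TTx : 0 <= T <= T by rewrite T0 lexx.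
have vL' : lip_curve T L v.
  by move=> x y /andP[? xT] /andP[? yT]; apply: vL; apply/andP; split=> //; apply: le_trans TT.
have := @lip_curve_FTC_le R T T L _ v (fun=> 0) TTx E0 vL' (bdm_cst T 0) (bdm_cst T 0) _.
have -> : cint `[0, T] (fun=> 0 : C) = 0 by rewrite /cint !Rintegral_cst// !mul0r.
rewrite subr0 v0 => vr.
have {}vr : normc (v T - r) <= 2 * (4 * (l ^+ 1 * (2 * normc r) ^+ 2) * T).
  apply: vr; apply: aeS vd => t H /H[d dv dl]; exists d => //.
  by have := dl 0%N; rewrite big_ord0.
have Er : 2 * (2 * (4 * (l ^+ 1 * (2 * normc r) ^+ 2) * T)) <= normc r.
  apply: (@le_trans _ _ (64 * (l * normc r * tpi) * normc r)); last first.
    by rewrite ler_piMl.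
  apply: (@le_trans _ _ (64 * (l * normc r * T) * normc r)).
    by rewrite le_eqVlt; apply/orP; left; apply/eqP; ring.
  by rewrite ler_wpM2r// ler_wpM2l// ler_wpM2l// mulr_ge0// ltW.
have := normcD (v T - r) r; rewrite subrK; lra.
Qed.

(** A continuation argument in equal steps: on a step of length
    [|r| / (2 (|L| + 1))] an [L]-Lipschitz solution grows by at most [|r| / 2],
    and up to the beginning of the step the bound [2 |r|] has improved itself to
    [3 |r| / 2]. *)
Lemma solution_le (r : C) (v : R -> C) : is_solution a r v ->
  64 * (l * normc r * tpi) <= 1 -> 4 * (l * normc r) <= 1 -> r != 0 ->
  forall x, 0 <= x <= tpi -> normc (v x) <= 2 * normc r.
Proof.
move=> sv r1 r2 r0; have [v0 [L vL] _] := sv.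
have rho0 : 0 < normc r.
  by rewrite lt_neqAle normc_ge0 andbT eq_sym; apply: contra r0 => /eqP/Normc.eq0_normc ->.
have L0 : 0 < `|L| + 1 by rewrite ltr_wpDl.
pose de := normc r / (2 * (`|L| + 1)).
have de0 : 0 < de by rewrite divr_gt0// mulr_gt0.
suff H n x : 0 <= x <= tpi -> x <= de *+ n -> normc (v x) <= 2 * normc r.
  move=> x /[dup] xT /andP[x0 _].
  apply: (H (Num.bound (x / de))) => //.
  by rewrite -mulr_natl -ler_pdivrMr// ltW// archi_boundP// divr_ge0// ltW.
elim: n x => [|n IH] x /andP[x0 xT].
  rewrite mulr0n => x0'; have -> : x = 0 by apply/eqP; rewrite eq_le x0 x0'.
  by rewrite v0; lra.
move=> xn; have [|nx] := leP x (de *+ n); first by apply: IH; rewrite x0.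
have y0 : 0 <= de *+ n by rewrite mulrn_wge0 ?ltW.
have yT : de *+ n <= tpi by rewrite (le_trans _ xT)// ltW.
have vy : 2 * normc (v (de *+ n)) <= 3 * normc r.
  apply: (solution_le_three_halves sv) => // t /andP[t0 tn]; apply: IH => //.
  by rewrite t0 (le_trans tn).
have : normc (v x - v (de *+ n)) <= normc r / 2.
  apply: le_trans (vL _ _ _ _) _; rewrite ?x0 ?y0//.
  have xn0 : 0 <= x - de *+ n by rewrite subr_ge0 ltW.
  rewrite ger0_norm//.
  have Lde : (`|L| + 1) * de = normc r / 2 by rewrite /de; field; exact: lt0r_neq0.
  apply: (@le_trans _ _ ((`|L| + 1) * (x - de *+ n))).
    by rewrite ler_wpM2r// ler_wpDr// ler_norm.
  by rewrite -Lde ler_wpM2l ?(ltW L0)// lerBlDr (le_trans xn)// mulrS.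
have := normcD (v x - v (de *+ n)) (v (de *+ n)); rewrite subrK.
by move=> h1 h2; lra.
Qed.

End SmallSolutions.

(** * Expansion of a solution in powers of its initial value *)

Section Expansion.
Variable R : realType.
Local Notation C := R[i].
Local Notation mu := (@lebesgue_measure R).
Local Notation Re := (@complex.Re R).
Local Notation Im := (@complex.Im R).
Local Notation tpi := (2 * pi : R).
Local Notation normc := (@Normc.normc R).

Lemma cbd_sum (I : Type) (s : seq I) (f : I -> R -> C) :
  (forall i, cbd (f i)) -> cbd (fun t => \sum_(i <- s) f i t).
Proof.
move=> cf; elim: s => [|i s IH].
  by under eq_fun do rewrite big_nil; exact: cbd_cst.
by under eq_fun do rewrite big_cons; exact: cbdD.
Qed.

Lemma oint_bigsum (I : Type) (s : seq I) (f : I -> R -> C) (x y : R) :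
  0 <= x -> y <= tpi -> (forall i, cbd (f i)) ->
  oint x y (fun t => \sum_(i <- s) f i t) = \sum_(i <- s) oint x y (f i).
Proof.
move=> x0 yT cf; elim: s => [|i s IH].
  rewrite big_nil -[RHS](mul0r (oint x y (fun=> 1))) -ointZ//; last exact: cbd_cst.
  by apply: eq_oint => t _; rewrite big_nil mul0r.
rewrite big_cons -IH -ointD//; last exact: cbd_sum.
by apply: eq_oint => t _; rewrite big_cons.
Qed.

Variable a : X R.

(** The coefficient of [r^(m+n)] in the expansion of [v(x; r; a)^m]. *)
Definition pow_coef (m n : nat) (x : R) : C :=
  word_sum m n (fun w => iter_int a w x).

Lemma cbd_pow_coef m n : cbd (pow_coef m n).
Proof.
by apply: cbd_sum => w; apply: cbdM; [exact: cbd_cst|exact/cbd_iter/XP].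
Qed.

Lemma oint_pow_coef m n k x : 0 <= x <= tpi ->
  oint 0 x (fun t => a k t * pow_coef m n t) =
  word_sum m n (fun w => iter_int a (rcons w k) x).
Proof.
move=> xT; have [x0 xT'] := andP xT.
transitivity (oint 0 x (fun t =>
    \sum_(w <- words n) (word_coef m w)%:R * (a k t * iter_int a w t))).
  by apply: eq_oint => t _; rewrite mulr_sumr; apply: eq_bigr => w _; rewrite mulrCA.
have cs w := cbd_step w k (XP a).
rewrite oint_bigsum//; last by move=> w; apply: cbdM => //; exact: cbd_cst.
by apply: eq_bigr => w _; rewrite ointZ// (iter_int_oint _ _ (XP a)).
Qed.

(** The field [m sum_(k < d) a_k v^(m+k+1)] of [v^m], with each power of [v]
    replaced by its expansion up to the term in [r^(m+d)]. *)
Definition truncated_field (m d : nat) (r : C) (t : R) : C :=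
  m%:R * \sum_(k < d) a k t * \sum_(n < d - k) pow_coef (m + k.+1) n t * r ^+ (m + k.+1 + n).

Lemma cbd_truncated_field m d r : cbd (truncated_field m d r).
Proof.
apply: cbdM; first exact: cbd_cst.
apply: cbd_sum => k; apply: cbdM; first exact: in_X_cbd (XP a).
by apply: cbd_sum => n; apply: cbdM; [exact: cbd_pow_coef|exact: cbd_cst].
Qed.

(** Integration of the truncated field reproduces the next coefficients: this is
    the recursion of [word_sum] on the last letter. *)
Lemma cint_truncated_field m d r x : 0 <= x <= tpi ->
  cint `[0, x] (truncated_field m d r) =
  \sum_(n < d) pow_coef m n.+1 x * r ^+ (m + n.+1).
Proof.
move=> xT; have [x0 xT'] := andP xT; rewrite cint_oint//; last exact: cbd_truncated_field.
pose f (k n : nat) t := r ^+ (m + k.+1 + n) * (a k t * pow_coef (m + k.+1) n t).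
have ca k n : cbd (fun t => a k t * pow_coef (m + k.+1) n t).
  by apply: cbdM; [exact: in_X_cbd (XP a)|exact: cbd_pow_coef].
have cf k n : cbd (f k n) by apply: cbdM => //; exact: cbd_cst.
transitivity (oint 0 x (fun t => m%:R * \sum_(k < d) \sum_(n < d - k) f k n t)).
  apply: eq_oint => t _; congr (_ * _); apply: eq_bigr => k _; rewrite mulr_sumr.
  by apply: eq_bigr => n _; rewrite /f; ring.
rewrite ointZ//; last by apply: cbd_sum => k; exact: cbd_sum.
rewrite oint_bigsum//; last by move=> k; exact: cbd_sum.
pose g k n := word_sum (m + k.+1) n (fun w => iter_int a (rcons w k) x) *
              r ^+ (m + k.+1 + n).
rewrite (eq_bigr (fun k : 'I_d => \sum_(n < d - k) g k n)).
  rewrite (sum_triangle d g) mulr_sumr; apply: eq_bigr => n _.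
  rewrite /pow_coef word_sumS -mulrA mulr_suml; congr (_ * _).
  apply: eq_bigr => k _; congr (_ * _ ^+ _).
  by rewrite -addnA addSn subnKC// -ltnS.
move=> k _; rewrite oint_bigsum//; apply: eq_bigr => n _.
by rewrite /f ointZ// oint_pow_coef// mulrC.
Qed.

Variable l : R.
Hypotheses (l0 : 0 < l) (al : {ae mu, forall x, 0 <= x <= tpi ->
  forall k, normc (a k x) <= l ^+ k.+1}).

Definition small_solution (r : C) (v : R -> C) := [/\ is_solution a r v,
  4 * (l * normc r) <= 1 & forall x, 0 <= x <= tpi -> normc (v x) <= 2 * normc r].

(** Induction on the order [d], for all exponents at once: the equation expresses
    [v^m] through integrals of [a_k v^(m+k+1)], and the exponent gained lowers
    the order to which these powers must be known.  The derivative of [v^m]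
    differs from the truncated field by the tail of the series and by the errors
    of the expansions of [v^(m+k+1)], both [O(|r|^(m+d))].  The exponent is
    written [m.+1] because [v^(m-1)] enters the derivative. *)
Lemma solution_pow_expansion d m : exists2 K : R, 0 <= K &
  forall r v, small_solution r v -> forall x, 0 <= x <= tpi ->
  normc (v x ^+ m.+1 - \sum_(n < d) pow_coef m.+1 n x * r ^+ (m.+1 + n)) <=
  K * normc r ^+ (m.+1 + d).
Proof.
elim/ltn_ind: d m => -[|d] IH m.
  exists (2 ^+ m.+1); first exact: exprn_ge0.
  move=> r v [_ _ vr] x xT; rewrite big_ord0 subr0 addn0 normcX -exprMn.
  by rewrite lerXn2r ?nnegrE ?mulr_ge0 ?normc_ge0// vr.
have /choice[K KP] : forall k : nat, exists K : R, 0 <= K /\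
    forall r v, small_solution r v -> forall x, 0 <= x <= tpi ->
    normc (v x ^+ (m.+1 + k.+1) -
      \sum_(n < d - k) pow_coef (m.+1 + k.+1) n x * r ^+ (m.+1 + k.+1 + n)) <=
    K * normc r ^+ (m.+1 + k.+1 + (d - k)).
  move=> k; have [K K0 KP] := IH (d - k)%N (leq_ltn_trans (leq_subr _ _) (ltnSn d)) (m + k.+1)%N.
  by exists K.
(* The first summand bounds the tail of the series, where the 4 is that of the
   partial sum estimate and the powers of 2 come from [|v| <= 2 |r|]. *)
pose E := m.+1%:R * (2 ^+ m * (4 * (l ^+ d.+1 * 2 ^+ d.+2)) + \sum_(k < d) l ^+ k.+1 * K k).
have E0 : 0 <= E.
  have two j : 0 <= 2 ^+ j :> R by exact: exprn_ge0.
  have lp : 0 <= l ^+ d.+1 by exact/exprn_ge0/ltW.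
  rewrite mulr_ge0// addr_ge0//.
    exact: mulr_ge0 (two m) (mulr_ge0 (ler0n _ 4) (mulr_ge0 lp (two d.+2))).
  by apply: sumr_ge0 => k _; rewrite mulr_ge0 ?exprn_ge0 ?(ltW l0)//; case: (KP k).
have tpi0 : 0 <= tpi by rewrite mulr_ge0// pi_ge0.
exists (2 * (E * tpi)); first exact: mulr_ge0 (ler0n _ 2) (mulr_ge0 E0 tpi0).
move=> r v sv x xT; have [sol r1 vr] := sv; have [v0 [L vL] _] := sol.
have rho0 := normc_ge0 r.
have [L' vL'] := lip_curveX m.+1 vL vr.
have ls : 2 * (l * (2 * normc r)) <= 1 by move: r1; rewrite (mulrCA l); lra.
have Er0 : 0 <= E * normc r ^+ (m + d.+2) by apply: mulr_ge0 E0 _; exact: exprn_ge0.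
have [cR cI] := cbd_truncated_field m.+1 d r.
have := lip_curve_FTC_le xT Er0 vL' cR cI.
have -> : (m.+1 + d.+1)%N = (m + d.+2)%N by rewrite addSnnS.
rewrite (cint_truncated_field _ _ _ xT) v0 big_ord_recl /= addn0.
rewrite [pow_coef _ 0 _]word_sum0 mul1r opprD addrA.
have -> : 2 * (E * tpi) * normc r ^+ (m + d.+2) = 2 * (E * normc r ^+ (m + d.+2) * tpi) by ring.
apply; have field := solution_field_le l0 al sol (lexx _) vr ls.
apply: aeS2 al field => t at_ H tT; have [D vD Ds] := H tT.
exists (m.+1%:R * v t ^+ m * D); first exact: is_cderiveX.
have tT' : 0 <= t <= tpi by case/andP: tT => *; rewrite !ltW.
have vt := vr _ tT'.
rewrite /truncated_field -mulrA -mulrBr Normc.normcM normc_nat /E -mulrA ler_wpM2l//.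
pose S := \sum_(k < d) a k t * v t ^+ k.+2.
have -> : v t ^+ m * D - \sum_(k < d) a k t *
    (\sum_(n < d - k) pow_coef (m.+1 + k.+1) n t * r ^+ (m.+1 + k.+1 + n)) =
  v t ^+ m * (D - S) + \sum_(k < d) a k t * (v t ^+ (m.+1 + k.+1) -
      \sum_(n < d - k) pow_coef (m.+1 + k.+1) n t * r ^+ (m.+1 + k.+1 + n)).
  under [X in _ = _ + X]eq_bigr do rewrite mulrBr.
  rewrite sumrB mulrBr addrA; congr (_ - _).
  rewrite /S mulr_sumr -[LHS](subrK (\sum_(i < d) v t ^+ m * (a i t * v t ^+ i.+2))).
  by congr (_ + _); apply: eq_bigr => k _; rewrite mulrCA -exprD addSnnS.
apply: le_trans (normcD _ _) _; rewrite mulrDl; apply: lerD.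
  rewrite Normc.normcM normcX.
  have -> : 2 ^+ m * (4 * (l ^+ d.+1 * 2 ^+ d.+2)) * normc r ^+ (m + d.+2) =
    (2 * normc r) ^+ m * (4 * (l ^+ d.+1 * (2 * normc r) ^+ d.+2)).
    by rewrite !exprMn exprD; ring.
  apply: ler_pM; rewrite ?exprn_ge0 ?normc_ge0//; last exact: Ds.
  by rewrite lerXn2r ?nnegrE ?mulr_ge0 ?normc_ge0.
apply: le_trans (normc_sum _ _) _; rewrite mulr_suml; apply: ler_sum => k _.
rewrite Normc.normcM -mulrA; apply: ler_pM; rewrite ?normc_ge0 ?at_//.
have kd : (m.+1 + k.+1 + (d - k) = m + d.+2)%N.
  by rewrite addSn addnS -!addSn -addnA subnKC -?addSnnS// ltnW.
by have [_ /(_ r v sv t tT')] := KP k; rewrite kd.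
Qed.

End Expansion.

(** * Trivial return and the quotient *)

Section TrivialReturn.
Variable R : realType.
Local Notation C := R[i].
Local Notation mu := (@lebesgue_measure R).
Local Notation Re := (@complex.Re R).
Local Notation Im := (@complex.Im R).
Local Notation tpi := (2 * pi : R).
Local Notation normc := (@Normc.normc R).

Lemma X_ae_bound (a : X R) : exists2 l : R, 0 < l &
  {ae mu, forall x, 0 <= x <= tpi -> forall k, normc (a k x) <= l ^+ k.+1}.
Proof.
have [_ _ [l l0 al]] := XP a; exists l => //.
by apply: aeS (ae_foralln al) => x H xT k; exact: H.
Qed.

(** After cancelling [r^(n+2)], the lowest coefficient is [O(|r|)]. *)
Lemma vanishing_coefs (c : nat -> C) (rho : R) : 0 < rho ->
  (forall N, exists K : R, forall r : C, r != 0 -> normc r < rho ->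
     normc (\sum_(n < N) c n * r ^+ n.+2) <= K * normc r ^+ N.+2) ->
  forall n, c n = 0.
Proof.
move=> rho0 cK; elim/ltn_ind => n IH; have [K KP] := cK n.+1.
have cn (e : R) : 0 < e -> e < rho -> normc (c n) <= K * e.
  move=> e0 er; have ne : normc (e%:C)%C = e.
    by rewrite /= expr0n /= addr0 sqrtr_sqr gtr0_norm.
  have en0 : (e%:C)%C != 0.
    by apply/eqP => /(congr1 normc); rewrite ne Normc.normc0 => e_0; rewrite e_0 ltxx in e0.
  have := KP (e%:C)%C en0; rewrite ne => /(_ er).
  rewrite big_ord_recr big1 /= ?add0r; last by move=> i _; rewrite IH ?mul0r.
  rewrite Normc.normcM normcX ne [e ^+ n.+3]exprS mulrA ler_pM2r// exprn_gt0//.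
apply/Normc.eq0_normc/eqP; rewrite eq_le normc_ge0 andbT leNgt; apply/negP => c0.
pose e := Num.min (rho / 2) (normc (c n) / (2 * (`|K| + 1))).
have K0 : 0 < `|K| + 1 by rewrite ltr_wpDl.
have e0 : 0 < e by rewrite lt_min !divr_gt0// mulr_gt0.
have er : e < rho by rewrite gt_min ltr_pdivrMr// ltr_pMr// ltr1n.
have := cn e e0 er; apply/negP; rewrite -ltNge.
apply: (@le_lt_trans _ _ ((`|K| + 1) * e)).
  by rewrite ler_wpM2r ?(ltW e0)// ler_wpDr// ler_norm.
apply: (@le_lt_trans _ _ ((`|K| + 1) * (normc (c n) / (2 * (`|K| + 1))))).
  by rewrite ler_wpM2l ?(ltW K0)// ge_min lexx orbT.
have -> : (`|K| + 1) * (normc (c n) / (2 * (`|K| + 1))) = normc (c n) / 2.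
  by field; exact: lt0r_neq0.
by rewrite ltr_pdivrMr// ltr_pMr// ltr1n.
Qed.

(** Without a solution the first return map takes the default value 0, which is
    not [r]; a nonzero fixed point therefore comes from a solution. *)
Lemma fixed_first_return (a : X R) (r : C) : r != 0 -> first_return a r = r ->
  exists2 v, is_solution a r v & v tpi = r.
Proof.
move=> r0; rewrite /first_return; case: xgetP => [v _ sv vr|_ h].
  by exists v.
by rewrite -h eqxx in r0.
Qed.

(** With [v(2 pi) = r], which is also the first term of the expansion of [v], the
    sum of the other terms is [O(|r|^(N+2))] for each [N]. *)
Lemma trivial_return_coef (a : X R) n : (1 <= n)%N -> trivial_return a ->
  c_coef n a = 0.
Proof.
case: n => [//|n] _ [rho rho0 ar]; rewrite c_coef_word_sum//.
have [l l0 al] := X_ae_bound a.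
have tpi0 : 0 < tpi by rewrite mulr_gt0// pi_gt0.
have tpiT : 0 <= tpi <= tpi by rewrite lexx ltW.
(* [|r| < 1 / B] gives both smallness conditions of [solution_le] at once. *)
pose B := 64 * (l * tpi) + 4 * l.
have B0 : 0 < B.
  by rewrite addr_gt0//; apply: mulr_gt0 => //; exact: mulr_gt0.
have rB : 0 < Num.min rho B^-1 by rewrite lt_min rho0 invr_gt0.
pose c i := pow_coef a 1 i.+1 tpi.
apply: (@vanishing_coefs c _ rB) => N.
have [K _ KP] := solution_pow_expansion l0 al N.+1 0.
exists K => r r0; rewrite lt_min => /andP[rr rB1].
have [v sv vT] := fixed_first_return r0 (ar _ rr).
have rho_r := normc_ge0 r.
have {}rB1 : B * normc r <= 1 by rewrite -ler_pdivlMl// mulr1 ltW.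
have p1 : 0 <= l * tpi * normc r by rewrite mulr_ge0// mulr_ge0// ltW.
have p2 : 0 <= l * normc r by rewrite mulr_ge0// ltW.
have r1 : 64 * (l * normc r * tpi) <= 1 by move: rB1; rewrite /B (mulrAC l); lra.
have r2 : 4 * (l * normc r) <= 1 by move: rB1; rewrite /B; lra.
have := KP r v (And3 sv r2 (solution_le l0 al sv r1 r2 r0)) tpi tpiT.
rewrite vT expr1 big_ord_recl /pow_coef word_sum0 mul1r addn0 expr1.
by rewrite opprD addrA subrr sub0r normcN.
Qed.

(** Constants solve the zero equation, and they are the only solutions because a
    Lipschitz function whose derivative vanishes almost everywhere is constant. *)
Lemma trivial_return_zero : trivial_return (zeroX R).
Proof.
exists 1 => // r _.
have tpi0 : 0 < tpi by rewrite mulr_gt0// pi_gt0.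
have tpiT : 0 <= tpi <= tpi by rewrite lexx ltW.
have s0 (v : R -> C) x (d : C) : csum_to (fun k => zeroX R k x * v x ^+ k.+2) d <-> d = 0.
  have z n : \sum_(k < n) zeroX R k x * v x ^+ k.+2 = 0.
    by rewrite big1// => k _; rewrite mul0r.
  split=> [ds|->].
    apply: Normc.eq0_normc; apply/eqP; rewrite eq_le normc_ge0 andbT.
    have := @csum_le _ _ d 0 0 0 ds; rewrite mulr0 subr0; apply=> n _.
    by rewrite z subrr Normc.normc0.
  by split; under eq_fun do rewrite z; exact: cvg_cst.
have ex : exists v, is_solution (zeroX R) r v.
  exists (cst r); split=> //.
    by exists 0 => x y _ _; rewrite subrr Normc.normc0 mul0r.
  apply: aeT => x _; exists 0; last exact/s0.
  by split; apply: is_derive_cst.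
rewrite /first_return; case: xgetP => [v _ [v0 [L vL] vd]|/(_ _)]; last by case: ex => v sv /(_ v).
have H := @lip_curve_FTC_le R tpi tpi L 0 v (fun=> 0) tpiT (lexx _) vL (bdm_cst _ 0) (bdm_cst _ 0).
have := H _.
have -> : cint `[0, tpi] (fun=> 0 : C) = 0 by rewrite /cint !Rintegral_cst// !mul0r.
rewrite mul0r mulr0 subr0 v0 => K; apply/eqP; rewrite -subr_eq0; apply/eqP/Normc.eq0_normc.
apply/eqP; rewrite eq_le normc_ge0 andbT; apply: K.
apply: aeS vd => x K xT; have [d dv /s0 d0] := K xT.
by exists d => //; rewrite d0 subrr Normc.normc0.
Qed.

(** When the series of [P(b)] is [r], composition with it leaves only the term
    [j = 0]. *)
Lemma c_hat_mulr_C_hat n (g h : G R) : (1 <= n)%N -> C_hat h ->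
  c_hat n (g * h)%g = c_hat n g.
Proof.
move=> n1 [b bt <-]; rewrite -(reprGK g) -[(_ * _)%g]/(mulG _ _) mulGE !c_hatE.
rewrite !c_coef_word_sum// total_concat word_sum_wconv big_ord_recl.
rewrite word_sum0 mul1r addn0 subn0 big1 ?addr0// => j _.
by rewrite -c_coef_word_sum// trivial_return_coef// mul0r.
Qed.

Lemma Q_inj (p q : Q R) : Q_set p = Q_set q -> p = q.
Proof.
case: p q => [A hA] [B hB] /= AB; subst B; congr MkQ; exact: Prop_irrelevance.
Qed.

Lemma projQ_surj (q : Q R) : exists g, q = projQ g.
Proof. by case: (q) => A [g gA]; exists g; apply: Q_inj. Qed.

(** As the unit is in [C_hat], [g] lies in its own coset, hence in that of [h]. *)
Lemma c_hat_projQ n (g h : G R) : (1 <= n)%N -> projQ g = projQ h ->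
  c_hat n g = c_hat n h.
Proof.
move=> n1 /(congr1 (@Q_set R)) /= gh.
have : coset_C_hat g g.
  by exists 1%g; [exists (zeroX R) => //; exact: trivial_return_zero|exact: mulG1].
by rewrite gh => -[k kC <-]; exact: c_hat_mulr_C_hat.
Qed.

End TrivialReturn.

Theorem proposition3p8 (R : realType) (n : nat) (n_ge1 : (1 <= n)%N) :
  (forall g h : G R, projQ g = projQ h -> c_hat n g = c_hat n h) /\
  (exists! c_bar : Q R -> R[i], c_bar \o @projQ R = c_hat n).
Proof.
have wd (g h : G R) : projQ g = projQ h -> c_hat n g = c_hat n h by exact: c_hat_projQ.
split=> //; have /choice[s sP] := @projQ_surj R.
exists (fun q => c_hat n (s q)); split.
  by apply/funext => g /=; apply: wd; rewrite -sP.
move=> c cE; apply/funext => q.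
by rewrite [in RHS](sP q) -cE.
Qed.
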